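(* Let $m \ge 2$. For $\mathbf{s} = (\mathbf{s}_1,\ldots,\mathbf{s}_m) \in \mathbb{R}^{U\times m}$ (each $\mathbf{s}_i \in \mathbb{R}^U$) define $$\Pi(\mathbf{s}) = \Lambda(\mathbf{s}_1) - \sum_{i=2}^m \Lambda(\mathbf{s}_i)\,\Lambda(\mathbf{s}_1)^{-1}\,\Lambda(\mathbf{s}_i) \in \mathbb{S}^L$$ whenever $\Lambda(\mathbf{s}_1)$ is invertible, and let $$K^\ast_{\ell_2} = \operatorname{cl}\{\mathbf{s} \in \mathbb{R}^{U\times m} : \Lambda(\mathbf{s}_1) \succ 0,\ \Pi(\mathbf{s}) \succ 0\}.$$ Then the function $F(\mathbf{s}) = -\log\det \Pi(\mathbf{s}) - \log\det \Lambda(\mathbf{s}_1)$, defined on $\{\mathbf{s} : \Lambda(\mathbf{s}_1)\succ 0,\ \Pi(\mathbf{s})\succ 0\}$ (the interior of $K^\ast_{\ell_2}$), is a $2L$-logarithmically homogeneous self-concordant barrier for $K^\ast_{\ell_2}$.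
   Context: Fix integers $n,d\ge 1$, and set $L=\binom{n+d}{n}$, $U=\binom{n+2d}{n}$. Let $\mathbf{t}_1,\ldots,\mathbf{t}_U\in\mathbb{R}^n$ be points that are unisolvent for $\mathbb{R}[\mathbf{x}]_{n,2d}$ (the polynomials in $n$ variables of degree at most $2d$), i.e. a polynomial of degree at most $2d$ vanishing at all of them is zero, and let $p_1,\ldots,p_L$ be a basis of $\mathbb{R}[\mathbf{x}]_{n,d}$. Let $\mathbf{P}\in\mathbb{R}^{U\times L}$ with $P_{u,\ell}=p_\ell(\mathbf{t}_u)$, and define the linear map $\Lambda:\mathbb{R}^U\to\mathbb{S}^L$ by $\Lambda(\mathbf{s})=\mathbf{P}^\top\operatorname{Diag}(\mathbf{s})\mathbf{P}$, where $\mathbb{S}^L$ denotes the real symmetric $L\times L$ matrices. A function $F$ on the interior of a closed convex cone $K$ with nonempty interior is a $\nu$-logarithmically homogeneous self-concordant barrier ($\nu$-LHSCB) if it is $C^3$ and convex, $F(\mathbf{x}_k)\to\infty$ whenever $\mathbf{x}_k$ converges to a point on the boundary of $K$, $|D^3F(\mathbf{x})[\mathbf{h},\mathbf{h},\mathbf{h}]|\le 2\,(D^2F(\mathbf{x})[\mathbf{h},\mathbf{h}])^{3/2}$ for all interior $\mathbf{x}$ and all directions $\mathbf{h}$, and $F(\tau\mathbf{x})=F(\mathbf{x})-\nu\log\tau$ for all $\tau>0$. *)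

(* Defs.v *)
From HB Require Import structures.
From mathcomp Require Import all_boot all_order all_algebra.
From mathcomp Require Import mpoly.
From mathcomp Require Import all_classical all_reals all_analysis.
Set Implicit Arguments. Unset Strict Implicit. Unset Printing Implicit Defensive.
Import Order.TTheory GRing.Theory Num.Theory.
Import numFieldNormedType.Exports.
Local Open Scope classical_set_scope.
Local Open Scope ring_scope.

Notation mpolyR n R := (mpoly.mpoly n R).

(* total degree bound: deg q <= k  <->  msize q <= k+1 (msize 0 = 0) *)
Definition deg_le (R : realType) (n k : nat) (q : mpolyR n R) : Prop :=
  (mpoly.msize q <= k.+1)%N.

Definition unisolvent (R : realType) (n k U : nat) (t : 'I_U -> 'I_n -> R) : Prop :=
  forall q : mpolyR n R, deg_le k q ->
    (forall u, mpoly.meval (t u) q = 0) -> q = 0.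

Definition is_basis_polys (R : realType) (n d L : nat) (p : 'I_L -> mpolyR n R) : Prop :=
  [/\ forall l, deg_le d (p l),
      forall a : 'I_L -> R, \sum_(l < L) a l *: p l = 0 -> forall l, a l = 0
    & forall q : mpolyR n R, deg_le d q ->
        exists a : 'I_L -> R, q = \sum_(l < L) a l *: p l].

Definition evmx (R : realType) (n U L : nat) (t : 'I_U -> 'I_n -> R)
  (p : 'I_L -> mpolyR n R) : 'M[R]_(U, L) :=
  \matrix_(u < U, l < L) mpoly.meval (t u) (p l).

Definition Lam (R : realType) (U L : nat) (P : 'M[R]_(U, L)) (s : 'cV[R]_U) : 'M[R]_L :=
  P^T *m diag_mx s^T *m P.

Definition posdef (R : realType) (L : nat) (A : 'M[R]_L) : Prop :=
  A^T = A /\ forall x : 'cV[R]_L, x != 0 -> 0 < (x^T *m A *m x) 0 0.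

(* Lambda(s_1), with s_1 the first column (index 0) of s *)
Definition Lam1 (R : realType) (U L m : nat) (P : 'M[R]_(U, L)) (s : 'M[R]_(U, m))
  : 'M[R]_L := \sum_(j < m | (j : nat) == 0%N) Lam P (col j s).

Definition Pi (R : realType) (U L m : nat) (P : 'M[R]_(U, L)) (s : 'M[R]_(U, m))
  : 'M[R]_L :=
  Lam1 P s - \sum_(j < m | (0 < j)%N) (Lam P (col j s) *m invmx (Lam1 P s) *m Lam P (col j s)).

Definition Kint (R : realType) (U L m : nat) (P : 'M[R]_(U, L)) : set 'M[R]_(U, m) :=
  [set s | posdef (Lam1 P s) /\ posdef (Pi P s)].

Arguments Kint {R U L} m P.

Definition Kstar (R : realType) (U L m : nat) (P : 'M[R]_(U, L)) : set 'M[R]_(U, m) :=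
  closure (Kint m P).
Arguments Kstar {R U L} m P.

Definition Fbar (R : realType) (U L m : nat) (P : 'M[R]_(U, L)) (s : 'M[R]_(U, m)) : R :=
  - ln (\det (Pi P s)) - ln (\det (Lam1 P s)).

Definition dd (R : realType) (V : normedModType R) (h : V) (f : V -> R) : V -> R :=
  fun x => 'D_h f x.

(* C^3 on an open set D: all iterated directional derivatives up to order 3
   exist and are continuous on D (finite-dimensional space). *)
Definition C3_on (R : realType) (V : normedModType R) (D : set V) (F : V -> R) : Prop :=
  forall h1 h2 h3 : V, forall x, D x ->
    {for x, continuous F} /\ derivable F x h1 /\
    {for x, continuous (dd h1 F)} /\ derivable (dd h1 F) x h2 /\
    {for x, continuous (dd h2 (dd h1 F))} /\ derivable (dd h2 (dd h1 F)) x h3 /\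
    {for x, continuous (dd h3 (dd h2 (dd h1 F)))}.

Definition closed_convex_cone (R : realType) (V : normedModType R) (K : set V) : Prop :=
  [/\ closed K,
      (forall x y l, K x -> K y -> 0 <= l <= 1 -> K (l *: x + (1 - l) *: y)),
      (forall x tau, K x -> 0 <= tau -> K (tau *: x))
    & interior K !=set0].

Definition LHSCB (R : realType) (V : normedModType R) (K : set V) (F : V -> R) (nu : R)
  : Prop :=
  closed_convex_cone K /\
  C3_on (interior K) F /\
  [/\ (forall x y l, interior K x -> interior K y -> 0 <= l <= 1 ->
         F (l *: x + (1 - l) *: y) <= l * F x + (1 - l) * F y),
      (forall (u : nat -> V) (x : V), (forall k, interior K (u k)) ->
         u @ \oo --> x -> K x -> ~ interior K x -> (F \o u) @ \oo --> +oo),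
      (forall x h, interior K x ->
         `| dd h (dd h (dd h F)) x | <= 2 * (dd h (dd h F) x) `^ (3 / 2))
    & (forall x tau, interior K x -> 0 < tau -> F (tau *: x) = F x - nu * ln tau)].

(* Main.v *)
Require Import Defs.
From HB Require Import structures.
From mathcomp Require Import all_boot all_order all_algebra.
From mathcomp Require Import mpoly.
From mathcomp Require Import all_classical all_reals all_analysis.
From mathcomp Require Import perm ring lra.
Set Implicit Arguments. Unset Strict Implicit. Unset Printing Implicit Defensive.
Import Order.TTheory GRing.Theory Num.Theory.
Import numFieldNormedType.Exports.
Local Open Scope classical_set_scope.
Local Open Scope ring_scope.

(** Let [W], [X] and [Y_i] be matrices depending linearly on [s], with [W] and [X] symmetric,
    and let [S = W - \sum_i Y_i^T X^-1 Y_i]; the theorem is the case [W = X = Lam1 P s],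
    [Y_i = Lam P s_i]. The form of the block arrow matrix with corner [W], diagonal blocks [X]
    and border blocks [Y_i] is linear in [s]; completing the square, positive definiteness of
    [X] and [S] becomes a family of strict linear inequalities in [s], which settles all the
    convex geometry.

    In a direction where [X' = H] and [Y_i' = K_i], put [A = S'] and [Z_i = K_i - H X^-1 Y_i].
    Then [S'' = - 2 Q] and [S''' = 6 T], with [Q = \sum_i Z_i^T X^-1 Z_i] and
    [T = \sum_i Z_i^T X^-1 H X^-1 Z_i], so that with [B = S^-1 A] and [C = X^-1 H]
      [F''  = tr B^2 + 2 tr (S^-1 Q) + tr C^2],
      [F''' = - 2 tr B^3 - 6 tr (B S^-1 Q) - 6 tr (S^-1 T) - 2 tr C^3].
    Factoring [S^-1 = G G^T] and [X^-1 = N N^T] turns these traces into Frobenius products; with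
    [a^2 = tr B^2], [h^2 = tr C^2], [q = tr (S^-1 Q)] self-concordance reduces to
    [a^3 + h^3 + 3 (a + h) q <= (a^2 + h^2 + 2 q)^(3/2)].

    At a boundary point [det X] or [det S] vanishes while [det S <= det W] stays bounded, so
    [det X * det S] tends to [0]. *)

Section FrobeniusNorm.
Variable R : rcfType.

Lemma quadratic_ge0_discr_le (a b c : R) :
  (forall t, 0 <= a + 2 * b * t + c * t ^+ 2) -> b ^+ 2 <= a * c.
Proof.
move=> q_ge0; pose p := Poly [:: a; 2 * b; c].
have : p`_1 ^+ 2 - 4 * p`_2 * p`_0 <= 0.
  apply: deg_le2_poly_ge0 => [|t]; first by rewrite size_Poly.
  rewrite horner_Poly/= mul0r add0r (_ : _ + a = a + 2 * b * t + c * t ^+ 2) ?q_ge0//.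
  by ring.
by rewrite !coefE/= exprMn; lra.
Qed.

Lemma sum_cauchy_schwarz (I : finType) (a b : I -> R) :
  (\sum_i a i * b i) ^+ 2 <= (\sum_i a i ^+ 2) * (\sum_i b i ^+ 2).
Proof.
apply: quadratic_ge0_discr_le => t.
rewrite mulr_sumr !mulr_suml -!big_split/=; apply: sumr_ge0 => i _.
rewrite (_ : _ + _ = (a i + t * b i) ^+ 2) ?sqr_ge0//; ring.
Qed.

Definition frob m n (A : 'M[R]_(m, n)) : R := Num.sqrt (\tr (A^T *m A)).

Lemma mxtrace_trmulE m n (A B : 'M[R]_(m, n)) :
  \tr (A^T *m B) = \sum_i A i.1 i.2 * B i.1 i.2.
Proof.
rewrite /mxtrace -(pair_bigA _ (fun i j => A i j * B i j))/= exchange_big/=.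
by apply: eq_bigr => j _; rewrite mxE; apply: eq_bigr => i _; rewrite mxE.
Qed.

Lemma frob_ge0 m n (A : 'M[R]_(m, n)) : 0 <= frob A.
Proof. exact: sqrtr_ge0. Qed.

Lemma sqr_frobE m n (A : 'M[R]_(m, n)) : frob A ^+ 2 = \sum_i A i.1 i.2 ^+ 2.
Proof.
have trE : \tr (A^T *m A) = \sum_i A i.1 i.2 ^+ 2.
  by rewrite mxtrace_trmulE; apply: eq_bigr => i _; rewrite expr2.
by rewrite sqr_sqrtr trE// sumr_ge0// => i _; exact: sqr_ge0.
Qed.

Lemma sqr_frob m n (A : 'M[R]_(m, n)) : frob A ^+ 2 = \tr (A^T *m A).
Proof. by rewrite sqr_frobE mxtrace_trmulE; apply: eq_bigr => i _; rewrite expr2. Qed.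

Lemma frob_tr m n (A : 'M[R]_(m, n)) : frob A^T = frob A.
Proof. by rewrite /frob trmxK mxtrace_mulC. Qed.

Lemma frob_gt0 m n (A : 'M[R]_(m, n)) : (0 < frob A) = (A != 0).
Proof.
rewrite lt_neqAle frob_ge0 andbT eq_sym; congr negb; apply/eqP/eqP => [A0|->].
  apply/matrixP => i j; rewrite mxE; apply/eqP; rewrite -sqrf_eq0; apply/eqP.
  have sum0 : \sum_i A i.1 i.2 ^+ 2 = 0 by rewrite -sqr_frobE A0 expr0n.
  exact: (psumr_eq0P (fun i _ => sqr_ge0 (A i.1 i.2)) sum0 (i := (i, j)) isT).
by rewrite /frob mulmx0 mxtrace0 sqrtr0.
Qed.

Lemma mxtrace_cauchy_schwarz m n (A B : 'M[R]_(m, n)) :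
  `|\tr (A^T *m B)| <= frob A * frob B.
Proof.
rewrite -ler_sqr ?nnegrE ?mulr_ge0 ?frob_ge0// exprMn !sqr_frobE.
by rewrite real_normK ?num_real// mxtrace_trmulE sum_cauchy_schwarz.
Qed.

Lemma frob_mulmx_le m n k (A : 'M[R]_(m, n)) (B : 'M[R]_(n, k)) :
  frob (A *m B) <= frob A * frob B.
Proof.
rewrite -ler_sqr ?nnegrE ?mulr_ge0 ?frob_ge0// exprMn !sqr_frobE.
rewrite -(pair_bigA _ (fun i j => A i j ^+ 2))/=.
rewrite -(pair_bigA _ (fun i j => B i j ^+ 2))/= [X in _ * X]exchange_big/=.
rewrite -(pair_bigA _ (fun i j => (A *m B) i j ^+ 2))/= mulr_suml.
apply: ler_sum => i _; rewrite mulr_sumr; apply: ler_sum => j _.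
by rewrite mxE sum_cauchy_schwarz.
Qed.

Lemma mxtrace_congr_le m n (A : 'M[R]_m) (W : 'M[R]_(m, n)) :
  `|\tr (W^T *m A *m W)| <= frob A * frob W ^+ 2.
Proof.
rewrite -mulmxA (le_trans (mxtrace_cauchy_schwarz _ _))// expr2 mulrCA.
by rewrite ler_wpM2l ?frob_ge0// frob_mulmx_le.
Qed.

Lemma mxtrace_cube_le n (A : 'M[R]_n) : A^T = A -> `|\tr (A *m A *m A)| <= frob A ^+ 3.
Proof. by move=> AT; rewrite -{1}AT exprS mxtrace_congr_le. Qed.

End FrobeniusNorm.

Definition mxform (R : pzSemiRingType) m n (y : 'cV[R]_m) (x : 'cV[R]_n) (A : 'M[R]_(m, n)) : R :=
  (y^T *m A *m x) 0 0.

Notation qform x := (mxform x x).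

Section BilinearForm.
Variable R : comNzRingType.

Fact mxform_is_linear m n (y : 'cV[R]_m) (x : 'cV[R]_n) : linear (mxform y x : _ -> R^o).
Proof. by move=> a A B; rewrite /mxform linearP/= mulmxDl -scalemxAl !mxE. Qed.

HB.instance Definition _ m n (y : 'cV[R]_m) (x : 'cV[R]_n) :=
  GRing.isLinear.Build R 'M[R]_(m, n) R^o *:%R (mxform y x) (mxform_is_linear y x).

Lemma mxform_tr m n (y : 'cV[R]_m) (x : 'cV[R]_n) A : mxform x y A^T = mxform y x A.
Proof.
rewrite /mxform; have -> : y^T *m A *m x = (x^T *m A^T *m y)^T by rewrite !trmx_mul !trmxK mulmxA.
by rewrite [RHS]mxE.
Qed.

Lemma mxformDl m n (y z : 'cV[R]_m) (x : 'cV[R]_n) A :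
  mxform (y + z) x A = mxform y x A + mxform z x A.
Proof. by rewrite /mxform linearD/= !mulmxDl mxE. Qed.

Lemma mxformDr m n (y : 'cV[R]_m) (x z : 'cV[R]_n) A :
  mxform y (x + z) A = mxform y x A + mxform y z A.
Proof. by rewrite /mxform mulmxDr mxE. Qed.

Lemma mxformZr m n a (y : 'cV[R]_m) (x : 'cV[R]_n) A :
  mxform y (a *: x) A = a * mxform y x A.
Proof. by rewrite /mxform -scalemxAr mxE. Qed.

Lemma mxformZl m n a (y : 'cV[R]_m) (x : 'cV[R]_n) A :
  mxform (a *: y) x A = a * mxform y x A.
Proof. by rewrite -mxform_tr mxformZr mxform_tr. Qed.

Lemma mxform0r m n (y : 'cV[R]_m) (A : 'M[R]_(m, n)) : mxform y 0 A = 0.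
Proof. by rewrite /mxform mulmx0 mxE. Qed.

Lemma mxform0l m n (x : 'cV[R]_n) (A : 'M[R]_(m, n)) : mxform 0 x A = 0.
Proof. by rewrite -mxform_tr mxform0r. Qed.

Lemma mxform_mulr m n k (y : 'cV[R]_m) (x : 'cV[R]_k) (C : 'M[R]_(n, k)) A :
  mxform y (C *m x) A = mxform y x (A *m C).
Proof. by rewrite /mxform !mulmxA. Qed.

Lemma mxform_mull m n k (y : 'cV[R]_k) (x : 'cV[R]_n) (C : 'M[R]_(m, k)) A :
  mxform (C *m y) x A = mxform y x (C^T *m A).
Proof. by rewrite /mxform trmx_mul !mulmxA. Qed.

Lemma qformD n (x y : 'cV[R]_n) (A : 'M[R]_n) : A^T = A ->
  qform (x + y) A = qform x A + 2 * mxform x y A + qform y A.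
Proof.
move=> AT; rewrite mxformDl !mxformDr.
by rewrite -(mxform_tr y x) AT mulr_natl mulr2n !addrA.
Qed.

Lemma qform_mulmx m n (x : 'cV[R]_n) (C : 'M[R]_(m, n)) A :
  qform (C *m x) A = qform x (C^T *m A *m C).
Proof. by rewrite mxform_mull mxform_mulr. Qed.

Lemma qform_block m n (y : 'cV[R]_m) (x : 'cV[R]_n) (A : 'M[R]_m) B (D : 'M[R]_n) :
  qform (col_mx y x) (block_mx A B B^T D) = qform y A + 2 * mxform y x B + qform x D.
Proof.
rewrite {1}/mxform tr_col_mx -mulmxA mul_block_col mul_row_col !mulmxDr !mulmxA.
rewrite mxE [X in X + _]mxE [X in _ + X]mxE -/(mxform x y B^T) mxform_tr.
rewrite -/(qform y A) -/(mxform y x B) -/(qform x D).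
by rewrite mulr_natl mulr2n !addrA.
Qed.

End BilinearForm.

Section SchurComplement.
Variables (R : comUnitRingType) (m n : nat).
Implicit Types (A : 'M[R]_m) (B : 'M[R]_(m, n)) (D : 'M[R]_n).

Lemma qform_complete_square A B (y : 'cV[R]_m) (x : 'cV[R]_n) :
  A^T = A -> A \in unitmx ->
  qform (y + invmx A *m B *m x) A =
  qform y A + 2 * mxform y x B + qform x (B^T *m invmx A *m B).
Proof.
move=> AT Au; rewrite qformD// mxform_mulr mulmxA mulmxV// mul1mx; congr (_ + _).
by rewrite qform_mulmx trmx_mul trmx_inv AT -!mulmxA mulKVmx.
Qed.

Lemma qform_block_schur A B D y x : A^T = A -> A \in unitmx ->
  qform (col_mx y x) (block_mx A B B^T D) =
  qform (y + invmx A *m B *m x) A + qform x (D - B^T *m invmx A *m B).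
Proof.
by move=> AT Au; rewrite qform_block qform_complete_square// linearB addrACA subrr addr0.
Qed.

Lemma det_block_schur A B (C : 'M[R]_(n, m)) D : A \in unitmx ->
  \det (block_mx A B C D) = \det A * \det (D - C *m invmx A *m B).
Proof.
move=> Au; have -> : block_mx A B C D =
    block_mx 1%:M 0 (C *m invmx A) 1%:M *m block_mx A B 0 (D - C *m invmx A *m B).
  rewrite mulmx_block !(mul1mx, mul0mx, mulmx0, addr0) mulmxKV//.
  by rewrite addrC subrK.
by rewrite det_mulmx det_lblock det_ublock !det1 !mul1r.
Qed.

End SchurComplement.

Section PositiveDefinite.
Variable R : realType.

Definition possemidef n (A : 'M[R]_n) : Prop := A^T = A /\ forall x, 0 <= qform x A.

Lemma posdefW n (A : 'M[R]_n) : posdef A -> possemidef A.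
Proof.
move=> [AT Apos]; split=> // x.
by have [->|/Apos/ltW//] := eqVneq x 0; rewrite mxform0l.
Qed.

Lemma posdef_unit n (A : 'M[R]_n) : posdef A -> A \in unitmx.
Proof.
move=> [_ Apos]; rewrite -row_free_unit; apply: inj_row_free => v vA0.
apply/eqP; rewrite -trmx_eq0; apply: contraPT vA0 => /Apos.
by rewrite trmxK => vAv_gt0 vA0; rewrite vA0 mul0mx mxE ltxx in vAv_gt0.
Qed.

Lemma posdef_le n (A B : 'M[R]_n) : posdef A -> B^T = B ->
  (forall x, qform x A <= qform x B) -> posdef B.
Proof. by move=> [_ Apos] BT leAB; split=> // x /Apos/lt_le_trans; apply; exact: leAB. Qed.

Lemma mxform_cauchy_schwarz n (A : 'M[R]_n) x y : possemidef A ->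
  mxform x y A ^+ 2 <= qform x A * qform y A.
Proof.
move=> [AT A_ge0]; apply: quadratic_ge0_discr_le => t.
have := A_ge0 (x + t *: y); rewrite qformD// !(mxformZr, mxformZl).
by congr (0 <= _); ring.
Qed.

Lemma possemidef_unit_posdef n (A : 'M[R]_n) :
  possemidef A -> A \in unitmx -> posdef A.
Proof.
move=> Apsd Au; have [AT A_ge0] := Apsd; split=> // x xN0.
rewrite -/(qform x A) lt_neqAle A_ge0 andbT.
apply: contra xN0 => /eqP qx0; rewrite -[x](mulKmx Au).
suff -> : A *m x = 0 by rewrite mulmx0.
have := mxform_cauchy_schwarz x (A *m x) Apsd; rewrite -qx0 mul0r -mxform_tr AT.
rewrite /mxform -mulmxA -trace_mx11 -sqr_frob -exprM => frob_le0.
by apply/eqP; apply: contraTT frob_le0; rewrite -frob_gt0 -ltNge => /exprn_gt0.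
Qed.

Lemma posdef_block m n (A : 'M[R]_m) (B : 'M[R]_(m, n)) (D : 'M[R]_n) :
  posdef (block_mx A B B^T D) -> posdef A /\ posdef (D - B^T *m invmx A *m B).
Proof.
rewrite /posdef tr_block_mx => -[/eq_block_mx[AT _ _ DT] pos].
have Apos : posdef A.
  split=> // y yN0; have := pos (col_mx y 0); rewrite col_mx_eq0 negb_and yN0 => /(_ isT).
  by rewrite -!/(qform _ _) qform_block !(mxform0r, mxform0l) mulr0 !addr0.
split=> //; split.
  by rewrite linearB/= DT !trmx_mul trmxK trmx_inv AT mulmxA.
move=> x xN0; have := pos (col_mx (- (invmx A *m B *m x)) x).
rewrite col_mx_eq0 negb_and xN0 orbT => /(_ isT).
by rewrite -!/(qform _ _) qform_block_schur ?posdef_unit// addNr mxform0l add0r.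
Qed.

Lemma symmetric_blockE m n (A : 'M[R]_(m + n)) : A^T = A ->
  A = block_mx (ulsubmx A) (ursubmx A) (ursubmx A)^T (drsubmx A).
Proof. by move=> AT; rewrite trmx_ursub AT submxK. Qed.

Lemma cholesky n (A : 'M[R]_n) : posdef A -> exists2 M, M \in unitmx & A = M^T *m M.
Proof.
elim: n A => [A _|n IH A]; first by exists 1%:M; [exact: unitmx1|apply/matrixP; case].
rewrite -[n.+1]add1n in A * => Apos; move: (Apos); rewrite [A]symmetric_blockE; last by case: Apos.
move: (ulsubmx A) (ursubmx A) (drsubmx A) => a b D /posdef_block[[_ apos] /IH[N Nu NE]].
have a00_gt0 : 0 < a 0 0.
  by have := apos 1 (oner_neq0 _); rewrite trmx1 mul1mx mulmx1.
set s := Num.sqrt (a 0 0); have s_gt0 : 0 < s by rewrite sqrtr_gt0.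
have aE : a = (s ^+ 2)%:M by rewrite sqr_sqrtr ?ltW// -mx11_scalar.
exists (block_mx s%:M (s^-1 *: b) 0 N).
  by rewrite unitmxE det_ublock det_scalar1 unitrM unitfE gt_eqF.
rewrite tr_block_mx mulmx_block tr_scalar_mx trmx0 !mul0mx !mulmx0 !addr0 -NE aE.
rewrite invmx_scalar [(_ *: b)^T]linearZ/= !(mul_mx_scalar, mul_scalar_mx).
rewrite -!(scalemxAl, scalemxAr) !scalerA -invfM -expr2 mulfV ?gt_eqF// !scale1r.
by rewrite scale_scalar_mx -expr2 addrC subrK.
Qed.

Lemma posdef_det_gt0 n (A : 'M[R]_n) : posdef A -> 0 < \det A.
Proof.
move=> /cholesky[M Mu ->]; rewrite det_mulmx det_tr -expr2 exprn_even_gt0//=.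
by rewrite -unitfE -unitmxE.
Qed.

Lemma posdef_invmx_factor n (A : 'M[R]_n) : posdef A -> exists G : 'M[R]_n, invmx A = G *m G^T.
Proof.
move=> Apos; have [M Mu AE] := cholesky Apos; exists (invmx M).
apply: (can_inj (mulKmx (posdef_unit Apos))); rewrite mulmxV ?posdef_unit// AE.
by rewrite -mulmxA mulKVmx// trmx_inv mulmxV ?unitmx_tr.
Qed.

(* A Schur complement is the partial minimum of the quadratic form over the
   eliminated variables, so it inherits the order. *)
Lemma posdef_det_le n (A B : 'M[R]_n) : posdef A -> B^T = B ->
  (forall x, qform x A <= qform x B) -> \det A <= \det B.
Proof.
elim: n A B => [A B _ _ _|n IH A B]; first by rewrite !det_mx00.
rewrite -[n.+1]add1n in A B * => Apos BT leAB; have Bpos := posdef_le Apos BT leAB.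
move: (Apos) (Bpos) leAB; rewrite [A]symmetric_blockE; last by case: Apos.
rewrite [B]symmetric_blockE//.
move: (ulsubmx A) (ursubmx A) (drsubmx A) => a b D.
move: (ulsubmx B) (ursubmx B) (drsubmx B) => a' b' D'.
move=> /posdef_block[apos Spos] /posdef_block[a'pos S'pos] leAB.
have a_le : \det a <= \det a'.
  have := leAB (col_mx 1 0); rewrite !qform_block !(mxform0r, mxform0l) mulr0 !addr0.
  by rewrite /mxform trmx1 !mul1mx !mulmx1 !det_mx11.
rewrite !det_block_schur ?posdef_unit//.
apply: ler_pM; rewrite ?(ltW (posdef_det_gt0 _))//.
apply: IH => // [|x]; first by case: S'pos.
have := leAB (col_mx (- (invmx a' *m b' *m x)) x).
have [aT _] := apos; have [a'T _] := a'pos.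
rewrite !qform_block_schur ?posdef_unit// addNr mxform0l add0r; apply: le_trans; rewrite lerDr.
by case: (posdefW apos).
Qed.

Lemma normr_qform_le n (A : 'M[R]_n) x : `|qform x A| <= frob A * frob x ^+ 2.
Proof. by have := mxtrace_congr_le A x; rewrite trace_mx11. Qed.

Lemma posdef_coercive n (A : 'M[R]_n) : posdef A ->
  exists2 c, 0 < c & forall x, c * frob x ^+ 2 <= qform x A.
Proof.
move=> /cholesky[M Mu ->]; exists (frob (invmx M) ^+ 2 + 1)^-1 => [|x].
  by rewrite invr_gt0 ltr_wpDl ?sqr_ge0.
have -> : qform x (M^T *m M) = frob (M *m x) ^+ 2.
  by rewrite sqr_frob trace_mx11 trmx_mul !mulmxA /mxform !mulmxA.
rewrite ler_pdivrMl ?ltr_wpDl ?sqr_ge0//.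
have := frob_mulmx_le (invmx M) (M *m x); rewrite mulKmx// => frobx_le.
apply: (@le_trans _ _ (frob (invmx M) ^+ 2 * frob (M *m x) ^+ 2)).
  by rewrite -exprMn ler_sqr ?nnegrE ?mulr_ge0 ?frob_ge0.
by rewrite ler_wpM2r ?sqr_ge0// lerDl.
Qed.

Lemma frob_continuous m n : continuous (@frob R m n).
Proof.
have tr_continuous : continuous (fun B : 'M[R]_(m, n) => \tr (B^T *m B)).
  under eq_fun do rewrite mxtrace_trmulE.
  apply: continuous_big => [|i _ B]; first exact: add_continuous.
  by apply: continuousM; exact: coord_continuous.
move=> A; apply: continuous_comp; [exact: tr_continuous|exact: sqrt_continuous].
Qed.

Lemma posdef_near n (A : 'M[R]_n) : posdef A -> \forall B \near A, B^T = B -> posdef B.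
Proof.
move=> /posdef_coercive[c c_gt0 Ac].
have : frob (B - A) @[B --> A] --> frob (A - A).
  apply: (@continuous_comp _ _ _ (fun B : 'M[R]_n => B - A) (@frob R n n)).
    by apply: continuousB; [exact: cvg_id|exact: cst_continuous].
  exact: frob_continuous.
rewrite subrr {2}/frob mulmx0 mxtrace0 sqrtr0 => /cvgr_lt/(_ _ c_gt0).
apply: filterS => B B_lt BT; split=> // x xN0; rewrite -/(qform x B).
have frobx_gt0 : 0 < frob x ^+ 2 by rewrite exprn_gt0 ?frob_gt0.
have BA : frob (B - A) * frob x ^+ 2 < c * frob x ^+ 2 by rewrite ltr_pM2r.
have := normr_qform_le (B - A) x; rewrite linearB ler_norml => /andP[diff_ge _].
have := Ac x; lra.
Qed.

End PositiveDefinite.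

Section MatrixConvergence.
Variable R : realType.

Lemma cvg_mxP (T : Type) (F : set_system T) m n (f : T -> 'M[R]_(m, n)) (M : 'M[R]_(m, n)) :
  Filter F -> f @ F --> M <-> forall i j, f t i j @[t --> F] --> M i j.
Proof.
move=> FF; split=> [fM i j|fM P [Q nQ QP]].
  exact: (continuous_cvg _ (@coord_continuous R m n i j M) fM).
apply: filterS QP _; apply: filter_forall => i; apply: filter_forall => j.
exact: fM (nQ i j).
Qed.

Lemma mx_linear_continuous m n (W : normedModType R) (f : {linear 'M[R]_(m, n) -> W}) :
  continuous f.
Proof.
have -> : (f : _ -> _) = fun A => \sum_i \sum_j A i j *: f (delta_mx i j).
  apply/funext => A; rewrite {1}[A]matrix_sum_delta linear_sum; apply: eq_bigr => i _.
  by rewrite linear_sum; apply: eq_bigr => j _; rewrite linearZ.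
apply: continuous_big => [|i _]; first exact: add_continuous.
apply: continuous_big => [|j _ A]; first exact: add_continuous.
by apply: continuousZr_tmp; exact: coord_continuous.
Qed.

End MatrixConvergence.

Section DirectionalDerivative.
Variables (R : realType) (V : normedModType R).
Implicit Types (x v : V).

Lemma line_continuous v x : continuous (fun t : R => t *: v + x).
Proof. by move=> t; apply: cvgD; [exact: scalel_continuous|exact: cvg_cst]. Qed.

Lemma is_derive_linear (W : normedModType R) (f : {linear V -> W}) x v :
  continuous f -> is_derive x v f (f v).
Proof.
move=> f_cont; have f_diff : differentiable f x by exact: linear_differentiable.
by apply: DeriveDef; [exact: diff_derivable|rewrite deriveE// diff_lin].
Qed.

Lemma is_derive_comp_linear (W W' : normedModType R) (l : {linear W -> W'}) (f : V -> W) x v df :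
  continuous l -> is_derive x v f df -> is_derive x v (l \o f) (l df).
Proof.
move=> l_cont [f_der <-].
have quot_cvg : h^-1 *: (((l \o f) \o shift x) (h *: v) - (l \o f) x) @[h --> 0^'] -->
    l ('D_v f x).
  under eq_fun do rewrite /= -linearB -linearZ.
  exact: cvg_comp f_der (l_cont _).
by apply: DeriveDef; [apply/cvg_ex; exists (l ('D_v f x))|exact: cvg_lim].
Qed.

Lemma is_derive_line (W : normedModType R) (f : V -> W) x v (t : R) d :
  is_derive (t *: v + x) v f d <-> is_derive t 1 (fun s : R => f (s *: v + x)) d.
Proof.
have quotE : (fun h : R => h^-1 *: ((f \o shift (t *: v + x)) (h *: v) - f (t *: v + x))) =
  (fun h : R => h^-1 *: (((fun s : R => f (s *: v + x)) \o shift t) (h *: (1 : R))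
     - f (t *: v + x))).
  apply/funext => h /=; congr (_ *: (f _ - _)).
  by rewrite addrA -scalerDl [h *: 1]mulr1.
by split=> -[]; rewrite /derivable /derive ?quotE -?quotE => f_der fE; split;
  rewrite /derivable /derive ?quotE -?quotE.
Qed.

Lemma is_derive_comp1 (g : R -> R) (f : V -> R) x v dg df :
  is_derive (f x) 1 g dg -> is_derive x v f df -> is_derive x v (g \o f) (dg * df).
Proof.
rewrite -{1 2 3}[x]add0r -(scale0r v) => g_der /is_derive_line f_der.
by apply/is_derive_line; exact: (@is_derive1_comp _ g (fun s : R => f (s *: v + x))).
Qed.

Lemma is_derive_bigsum (W : normedModType R) I (r : seq I) (P : pred I) (F : I -> V -> W) dF x v :
  (forall i, is_derive x v (F i) (dF i)) ->
  is_derive x v (fun y => \sum_(i <- r | P i) F i y) (\sum_(i <- r | P i) dF i).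
Proof.
move=> F_der; elim: r => [|i r IH].
  by rewrite big_nil; under eq_fun do rewrite big_nil; exact: is_derive_cst.
rewrite big_cons; under eq_fun do rewrite big_cons.
by case: (P i) => //; exact: is_deriveD (F_der i) IH.
Qed.

Lemma is_derive_bigprod (I : eqType) (r : seq I) (F : I -> V -> R) dF x v :
  uniq r -> (forall i, is_derive x v (F i) (dF i)) ->
  is_derive x v (fun y => \prod_(i <- r) F i y)
    (\sum_(i <- r) \prod_(j <- r) (if j == i then dF j else F j x)).
Proof.
move=> + F_der; elim: r => [_|i r IH /= /andP[ir /IH prod_der]].
  by rewrite big_nil; under eq_fun do rewrite big_nil; exact: is_derive_cst.
under eq_fun do rewrite big_cons.
apply: is_derive_eq (is_deriveM (F_der i) prod_der) _.
rewrite big_cons big_cons eqxx addrC; congr (_ + _); rewrite /GRing.scale/=.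
  rewrite mulrC; congr (_ * _); rewrite !big_seq; apply: eq_bigr => j jr.
  by case: eqP => // ji; rewrite -ji jr in ir.
rewrite mulr_sumr !big_seq; apply: eq_bigr => k kr.
by rewrite big_cons; case: eqP => // ik; rewrite ik kr in ir.
Qed.

Lemma is_derive_mxP m n (A : V -> 'M[R]_(m, n)) x v dA :
  is_derive x v A dA <-> forall i j, is_derive x v (fun y => A y i j) (dA i j).
Proof.
split=> [[A_der <-] i j|A_der].
  have /derivable_mxP/(_ i j) Aij_der := A_der.
  by apply: DeriveDef => //; rewrite derive_mx// mxE.
have derA : derivable A x v by apply/derivable_mxP => i j; exact: ex_derive.
apply: DeriveDef => //; rewrite derive_mx//; apply/matrixP => i j.
by rewrite mxE derive_val.
Qed.

Lemma is_derive_mulmx m n p (A : V -> 'M[R]_(m, n)) (B : V -> 'M[R]_(n, p)) x v dA dB :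
  is_derive x v A dA -> is_derive x v B dB ->
  is_derive x v (fun y => A y *m B y) (dA *m B x + A x *m dB).
Proof.
move=> /is_derive_mxP A_der /is_derive_mxP B_der; apply/is_derive_mxP => i j.
rewrite !mxE -big_split/=; under eq_fun do rewrite mxE.
apply: is_derive_bigsum => k.
by apply: is_derive_eq (is_deriveM (A_der i k) (B_der k j)) _; rewrite addrC [_ *: dA i k]mulrC.
Qed.

Lemma is_derive_trmx m n (A : V -> 'M[R]_(m, n)) x v dA :
  is_derive x v A dA -> is_derive x v (fun y => (A y)^T) dA^T.
Proof. exact: (is_derive_comp_linear (@mx_linear_continuous _ _ _ _ trmx)). Qed.

Lemma is_derive_mxtrace n (A : V -> 'M[R]_n) x v dA :
  is_derive x v A dA -> is_derive x v (fun y => \tr (A y)) (\tr dA).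
Proof. exact: (is_derive_comp_linear (@mx_linear_continuous _ _ _ _ mxtrace)). Qed.

Lemma is_derive_det n (A : V -> 'M[R]_n) x v dA :
  is_derive x v A dA -> is_derive x v (fun y => \det (A y)) (\tr (\adj (A x) *m dA)).
Proof.
move=> /is_derive_mxP A_der.
pose row_derived i := \matrix_(k, l) (if k == i then dA k l else A x k l).
have -> : \tr (\adj (A x) *m dA) = \sum_i \det (row_derived i).
  rewrite mxtrace_mulC; apply: eq_bigr => i _.
  rewrite (expand_det_row _ i) mxE; apply: eq_bigr => j _.
  rewrite !mxE eqxx; congr (_ * (_ * \det _)); apply/matrixP => k l; rewrite !mxE.
  by rewrite eq_sym (negbTE (neq_lift _ _)).
rewrite /determinant exchange_big/=; apply: is_derive_bigsum => s.
rewrite -mulr_sumr; apply: is_deriveZ.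
apply: is_derive_eq (is_derive_bigprod (index_enum_uniq _) (fun i => A_der i (s i))) _.
by apply: eq_bigr => i _; apply: eq_bigr => j _; rewrite mxE.
Qed.

End DirectionalDerivative.

Section ContinuouslyDifferentiable.
Variables (R : realType) (V : normedModType R) (D : set V).

Fixpoint Ck_on k (W : normedModType R) (f : V -> W) : Prop :=
  (forall x, D x -> {for x, continuous f}) /\
  if k is k'.+1 then forall h, (forall x, D x -> derivable f x h) /\ Ck_on k' ('D_h f)
  else True.

Lemma Ck_on_continuous k (W : normedModType R) (f : V -> W) x :
  Ck_on k f -> D x -> {for x, continuous f}.
Proof. by case: k => [|k] [+ _]; exact. Qed.

Lemma Ck_onS_is_derive k (W : normedModType R) (f : V -> W) x h :
  Ck_on k.+1 f -> D x -> is_derive x h f ('D_h f x).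
Proof. by move=> [_ /(_ h)[+ _]] Dx => /(_ _ Dx)/derivableP. Qed.

Lemma Ck_onS_derive k (W : normedModType R) (f : V -> W) h : Ck_on k.+1 f -> Ck_on k ('D_h f).
Proof. by move=> [_ /(_ h)[]]. Qed.

Lemma Ck_onW k (W : normedModType R) (f : V -> W) : Ck_on k.+1 f -> Ck_on k f.
Proof.
elim: k f => [|k IH] f [fc fd]; first by split.
by split=> // h; have [? /IH] := fd h.
Qed.

Lemma Ck_on_C3_on (f : V -> R) : Ck_on 3 f -> C3_on D f.
Proof.
move=> C3 h1 h2 h3 x Dx.
have C2 := Ck_onS_derive h1 C3; have C1 := Ck_onS_derive h2 C2; have C0 := Ck_onS_derive h3 C1.
split; first exact: Ck_on_continuous C3 Dx.
split; first by have [] := Ck_onS_is_derive h1 C3 Dx.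
split; first exact: Ck_on_continuous C2 Dx.
split; first by have [] := Ck_onS_is_derive h2 C2 Dx.
split; first exact: Ck_on_continuous C1 Dx.
split; first by have [] := Ck_onS_is_derive h3 C1 Dx.
exact: Ck_on_continuous C0 Dx.
Qed.

Hypothesis D_open : open D.

Lemma open_near x (P : V -> Prop) : D x -> (forall y, D y -> P y) -> \forall y \near x, P y.
Proof. by move=> Dx DP; apply: (filterS DP); exact: open_nbhs_nbhs. Qed.

Lemma eq_Ck_on k (W : normedModType R) (f g : V -> W) :
  (forall y, D y -> f y = g y) -> Ck_on k f -> Ck_on k g.
Proof.
have g_cont (f' g' : V -> W) : (forall y, D y -> f' y = g' y) ->
    (forall x, D x -> {for x, continuous f'}) -> forall x, D x -> {for x, continuous g'}.
  move=> fg fc x Dx; rewrite /prop_for /continuous_at -fg//.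
  by apply: cvg_trans (fc _ Dx); apply: near_eq_cvg; exact: open_near.
elim: k f g => [|k IH] f g fg [fc fd]; first by split=> //; exact: g_cont fg fc.
split=> [|h]; first exact: g_cont fg fc.
have [fdh fCk] := fd h; split=> [x Dx|].
  by apply: near_eq_derivable (fdh _ Dx); exact: open_near.
by apply: IH fCk => y Dy; apply: near_eq_derive; exact: open_near.
Qed.

Lemma Ck_onS k (W : normedModType R) (f : V -> W) (f' : V -> V -> W) :
  (forall x, D x -> {for x, continuous f}) ->
  (forall h x, D x -> is_derive x h f (f' h x)) -> (forall h, Ck_on k (f' h)) -> Ck_on k.+1 f.
Proof.
move=> fc fd f'C; split=> // h; split=> [x /fd-/(_ h)//|].
by apply: eq_Ck_on (f'C h) => y /fd-/(_ h) [].
Qed.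

Lemma Ck_on_cst k (W : normedModType R) (c : W) : Ck_on k (fun=> c).
Proof.
have cst_cont (a : W) x : {for x, continuous (fun _ : V => a)} by exact: cst_continuous.
elim: k c => [|k IH] c; first by split.
by apply: (Ck_onS (f' := fun _ _ => 0)).
Qed.

Lemma Ck_on_linear k (W : normedModType R) (f : {linear V -> W}) : continuous f -> Ck_on k f.
Proof.
move=> f_cont; case: k => [|k]; first by split=> // x _; exact: f_cont.
apply: (Ck_onS (f' := fun h _ => f h)) => [x _|h x _|h]; first exact: f_cont.
  exact: is_derive_linear.
exact: Ck_on_cst.
Qed.

Lemma Ck_onD k (W : normedModType R) (f g : V -> W) :
  Ck_on k f -> Ck_on k g -> Ck_on k (fun y => f y + g y).
Proof.
elim: k f g => [|k IH] f g fC gC.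
  by split=> // x Dx; apply: continuousD; [exact: fC.1|exact: gC.1].
apply: (Ck_onS (f' := fun h y => 'D_h f y + 'D_h g y)).
- by move=> x Dx; apply: continuousD; [exact: fC.1|exact: gC.1].
- by move=> h x Dx; exact: is_deriveD (Ck_onS_is_derive h fC Dx) (Ck_onS_is_derive h gC Dx).
- by move=> h; apply: IH; exact: Ck_onS_derive.
Qed.

Lemma Ck_on_comp_linear k (W W' : normedModType R) (l : {linear W -> W'}) (f : V -> W) :
  continuous l -> Ck_on k f -> Ck_on k (l \o f).
Proof.
move=> l_cont; elim: k f => [|k IH] f fC.
  by split=> // x Dx; apply: continuous_comp; [exact: fC.1|exact: l_cont].
apply: (Ck_onS (f' := fun h => l \o 'D_h f)).
- by move=> x Dx; apply: continuous_comp; [exact: fC.1|exact: l_cont].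
- by move=> h x Dx; exact: is_derive_comp_linear l_cont (Ck_onS_is_derive h fC Dx).
- by move=> h; apply: IH; exact: Ck_onS_derive.
Qed.

Lemma Ck_onN k (W : normedModType R) (f : V -> W) : Ck_on k f -> Ck_on k (fun y => - f y).
Proof. by apply: (@Ck_on_comp_linear k W W -%R); exact: opp_continuous. Qed.

Lemma Ck_on_sum k (W : normedModType R) I (r : seq I) (P : pred I) (F : I -> V -> W) :
  (forall i, Ck_on k (F i)) -> Ck_on k (fun y => \sum_(i <- r | P i) F i y).
Proof.
move=> FC; elim: r => [|i r IH]; first by under eq_fun do rewrite big_nil; exact: Ck_on_cst.
by under eq_fun do rewrite big_cons; case: (P i) => //; exact: Ck_onD.
Qed.

Implicit Types f g : V -> R.

Lemma Ck_onM k f g : Ck_on k f -> Ck_on k g -> Ck_on k (fun y => f y * g y).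
Proof.
elim: k f g => [|k IH] f g fC gC.
  by split=> // x Dx; apply: continuousM; [exact: fC.1|exact: gC.1].
apply: (Ck_onS (f' := fun h y => f y * 'D_h g y + g y * 'D_h f y)).
- by move=> x Dx; apply: continuousM; [exact: fC.1|exact: gC.1].
- by move=> h x Dx; exact: is_deriveM (Ck_onS_is_derive h fC Dx) (Ck_onS_is_derive h gC Dx).
- by move=> h; apply: Ck_onD; apply: IH; do ?[exact: Ck_onS_derive|exact: Ck_onW].
Qed.

Lemma Ck_on_prod k I (r : seq I) (P : pred I) (F : I -> V -> R) :
  (forall i, Ck_on k (F i)) -> Ck_on k (fun y => \prod_(i <- r | P i) F i y).
Proof.
move=> FC; elim: r => [|i r IH]; first by under eq_fun do rewrite big_nil; exact: Ck_on_cst.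
by under eq_fun do rewrite big_cons; case: (P i) => //; exact: Ck_onM.
Qed.

Lemma Ck_onV k f : (forall y, D y -> f y != 0) -> Ck_on k f -> Ck_on k (fun y => (f y)^-1).
Proof.
move=> f_neq0.
have inv_cont : Ck_on 0 f -> forall x, D x -> {for x, continuous (fun y => (f y)^-1)}.
  by move=> fC x Dx; apply: cvgV; [exact: f_neq0|exact: fC.1].
elim: k => [|k IH] fC; first by split=> //; exact: inv_cont.
apply: (Ck_onS (f' := fun h y => - ((f y)^-1 * (f y)^-1 * 'D_h f y))).
- by apply: inv_cont; case: fC.
- move=> h x Dx; have [f_der _] := Ck_onS_is_derive h fC Dx.
  apply: DeriveDef; first exact: derivableV (f_neq0 _ Dx) f_der.
  by rewrite deriveV// ?f_neq0// /GRing.scale/= expr2 invfM mulNr.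
- move=> h; apply: Ck_onN; apply: Ck_onM; last exact: Ck_onS_derive.
  by apply: Ck_onM; apply: IH; exact: Ck_onW.
Qed.

Lemma Ck_on_ln k f : (forall y, D y -> 0 < f y) -> Ck_on k f -> Ck_on k (fun y => ln (f y)).
Proof.
move=> f_gt0.
have ln_cont : Ck_on 0 f -> forall x, D x -> {for x, continuous (@ln R \o f)}.
  by move=> fC x Dx; apply: continuous_comp; [exact: fC.1|exact/continuous_ln/f_gt0].
case: k => [|k] fC; first by split=> //; exact: ln_cont.
apply: (Ck_onS (f' := fun h y => (f y)^-1 * 'D_h f y)).
- by apply: ln_cont; case: fC.
- move=> h x Dx; apply: is_derive_comp1 (Ck_onS_is_derive h fC Dx).
  exact/is_derive1_ln/f_gt0.
- move=> h; apply: Ck_onM; last exact: Ck_onS_derive.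
  by apply: Ck_onV; [move=> y /f_gt0/lt0r_neq0|exact: Ck_onW].
Qed.

Lemma Ck_on_mxP k m n (A : V -> 'M[R]_(m, n)) :
  Ck_on k A <-> forall i j, Ck_on k (fun y => A y i j).
Proof.
split=> [AC i j|].
  elim: k A AC => [|k IH] A AC.
    by split=> // x Dx; exact: ((cvg_mxP _ _ _).1 (AC.1 x Dx)).
  apply: (Ck_onS (f' := fun h y => 'D_h A y i j)) => [x Dx|h x Dx|h].
  - exact: ((cvg_mxP _ _ _).1 (AC.1 x Dx)).
  - exact: (is_derive_mxP _ _ _ _).1 (Ck_onS_is_derive h AC Dx) _ _.
  - exact: IH (Ck_onS_derive h AC).
elim: k A => [|k IH] A AC.
  by split=> // x Dx; apply/cvg_mxP => i j; exact: (AC i j).1.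
apply: (Ck_onS (f' := fun h y => \matrix_(i, j) 'D_h (fun z => A z i j) y)).
- by move=> x Dx; apply/cvg_mxP => i j; exact: (AC i j).1.
- move=> h x Dx; apply/is_derive_mxP => i j; rewrite mxE.
  exact: Ck_onS_is_derive (AC i j) Dx.
- move=> h; apply: IH => i j; under eq_fun do rewrite mxE.
  exact: Ck_onS_derive (AC i j).
Qed.

Lemma Ck_on_mulmx k m n p (A : V -> 'M[R]_(m, n)) (B : V -> 'M[R]_(n, p)) :
  Ck_on k A -> Ck_on k B -> Ck_on k (fun y => A y *m B y).
Proof.
move=> /Ck_on_mxP AC /Ck_on_mxP BC; apply/Ck_on_mxP => i j.
by under eq_fun do rewrite mxE; apply: Ck_on_sum => l; exact: Ck_onM.
Qed.

Lemma Ck_on_trmx k m n (A : V -> 'M[R]_(m, n)) : Ck_on k A -> Ck_on k (fun y => (A y)^T).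
Proof. exact: (Ck_on_comp_linear (@mx_linear_continuous _ _ _ _ trmx)). Qed.

Lemma Ck_on_det k n (A : V -> 'M[R]_n) : Ck_on k A -> Ck_on k (fun y => \det (A y)).
Proof.
move=> /Ck_on_mxP AC; rewrite /determinant; apply: Ck_on_sum => s.
by apply: Ck_onM; [exact: Ck_on_cst|apply: Ck_on_prod => i; exact: AC].
Qed.

Lemma Ck_on_invmx k n (A : V -> 'M[R]_n) :
  (forall y, D y -> A y \in unitmx) -> Ck_on k A -> Ck_on k (fun y => invmx (A y)).
Proof.
move=> A_unit AC; apply/Ck_on_mxP => i j.
apply: (@eq_Ck_on _ _ (fun y => (\det (A y))^-1 * cofactor (A y) j i)).
  by move=> y /A_unit Ayu; rewrite /invmx Ayu !mxE.
apply: Ck_onM.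
  by apply: Ck_onV; [move=> y /A_unit; rewrite unitmxE unitfE|exact: Ck_on_det].
apply: Ck_onM; first exact: Ck_on_cst.
apply: Ck_on_det; apply/Ck_on_mxP => p q; under eq_fun do rewrite !mxE.
exact: (Ck_on_mxP _ _).1 AC _ _.
Qed.

Lemma is_derive_invmx n (A : V -> 'M[R]_n) x v dA : (forall y, D y -> A y \in unitmx) ->
  Ck_on 1 A -> D x -> is_derive x v A dA ->
  is_derive x v (fun y => invmx (A y)) (- (invmx (A x) *m dA *m invmx (A x))).
Proof.
move=> A_unit AC Dx A_der.
have inv_der := Ck_onS_is_derive v (Ck_on_invmx A_unit AC) Dx.
apply: is_derive_eq (inv_der) _; set dI := 'D_v _ x.
have : is_derive x v (fun y => A y *m invmx (A y)) 0.
  apply: near_eq_is_derive (is_derive_cst 1%:M x v); apply: open_near Dx _ => y /A_unit Ayu.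
  by rewrite mulmxV.
move=> [_]; have [_ ->] := is_derive_mulmx A_der inv_der => /addr0_eq dAE.
by rewrite -[LHS](mulKmx (A_unit _ Dx)) -dAE mulmxN mulmxA.
Qed.

End ContinuouslyDifferentiable.

Lemma Ck_on_subset (R : realType) (V W : normedModType R) (D E : set V) k (f : V -> W) :
  E `<=` D -> Ck_on D k f -> Ck_on E k f.
Proof.
move=> ED; elim: k f => [|k IH] f [fc fd]; first by split=> // x /ED/fc.
split=> [x /ED/fc//|h]; have [fdh fCk] := fd h.
by split=> [x /ED/fdh//|]; exact: IH.
Qed.

Section LogDet.
Variable R : realType.

Definition logdet_der1 n (A A1 : 'M[R]_n) : R := \tr (invmx A *m A1).

Definition logdet_der2 n (A A1 A2 : 'M[R]_n) : R :=
  \tr (invmx A *m A2) - \tr (invmx A *m A1 *m (invmx A *m A1)).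

Definition logdet_der3 n (A A1 A2 A3 : 'M[R]_n) : R :=
  \tr (invmx A *m A3) - 3 * \tr (invmx A *m A1 *m (invmx A *m A2))
  + 2 * \tr (invmx A *m A1 *m (invmx A *m A1) *m (invmx A *m A1)).

Lemma is_derive_ln_det (V : normedModType R) n (A : V -> 'M[R]_n) x v A1 : 0 < \det (A x) ->
  is_derive x v A A1 -> is_derive x v (fun y => ln (\det (A y))) (logdet_der1 (A x) A1).
Proof.
move=> det_gt0 /is_derive_det det_der.
have ln_der := is_derive_comp1 (f := fun y => \det (A y)) (is_derive1_ln det_gt0) det_der.
apply: is_derive_eq ln_der _.
by rewrite /logdet_der1 /invmx unitmxE unitfE gt_eqF// -scalemxAl mxtraceZ.
Qed.

Section Derivatives.
Variables (V : normedModType R) (D : set V) (n : nat) (v : V) (A A1 A2 A3 : V -> 'M[R]_n).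
Hypotheses (D_open : open D) (A_unit : forall y, D y -> A y \in unitmx).
Hypothesis A_C1 : Ck_on D 1 A.
Hypothesis A_der : forall y, D y -> is_derive y v A (A1 y).
Hypothesis A1_der : forall y, D y -> is_derive y v A1 (A2 y).

Let invA_mul_der (B : V -> 'M[R]_n) B' y : D y -> is_derive y v B B' ->
  is_derive y v (fun y => invmx (A y) *m B y)
    (invmx (A y) *m B' - invmx (A y) *m A1 y *m (invmx (A y) *m B y)).
Proof.
move=> Dy B_der; have invA_der := is_derive_invmx D_open A_unit A_C1 Dy (A_der Dy).
apply: is_derive_eq (is_derive_mulmx invA_der B_der) _.
by rewrite mulNmx !mulmxA addrC.
Qed.

Lemma is_derive_logdet_der1 y : D y ->
  is_derive y v (fun y => logdet_der1 (A y) (A1 y)) (logdet_der2 (A y) (A1 y) (A2 y)).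
Proof.
move=> Dy; apply: is_derive_eq (is_derive_mxtrace (invA_mul_der Dy (A1_der Dy))) _.
by rewrite linearB.
Qed.

Hypothesis A2_der : forall y, D y -> is_derive y v A2 (A3 y).

Lemma is_derive_logdet_der2 y : D y ->
  is_derive y v (fun y => logdet_der2 (A y) (A1 y) (A2 y))
    (logdet_der3 (A y) (A1 y) (A2 y) (A3 y)).
Proof.
move=> Dy; have G1_der := invA_mul_der Dy (A1_der Dy).
have tr_der := is_derive_mxtrace (invA_mul_der Dy (A2_der Dy)).
apply: is_derive_eq (is_deriveB tr_der (is_derive_mxtrace (is_derive_mulmx G1_der G1_der))) _.
rewrite /logdet_der3.
move: (invmx (A y) *m A1 y) (invmx (A y) *m A2 y) (invmx (A y) *m A3 y) => G1 G2 G3.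
by rewrite mulmxBl mulmxBr !(linearD, linearN)/= (mulmxA G1 G1) (mxtrace_mulC G2); ring.
Qed.

End Derivatives.

Section Congruence.
Variables (n : nat) (A G : 'M[R]_n).
Hypothesis invA : invmx A = G *m G^T.

Definition congrmx (B : 'M[R]_n) : 'M[R]_n := G^T *m B *m G.

Lemma logdet_der2_congr A1 A2 : logdet_der2 A A1 A2 =
  \tr (congrmx A2) - \tr (congrmx A1 *m congrmx A1).
Proof.
rewrite /logdet_der2 /congrmx invA -!mulmxA; by congr (_ - _); rewrite mxtrace_mulC -!mulmxA.
Qed.

Lemma logdet_der3_congr A1 A2 A3 : logdet_der3 A A1 A2 A3 =
  \tr (congrmx A3) - 3 * \tr (congrmx A1 *m congrmx A2)
  + 2 * \tr (congrmx A1 *m congrmx A1 *m congrmx A1).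
Proof.
rewrite /logdet_der3 /congrmx invA -!mulmxA.
by congr (_ - _ * _ + _ * _); rewrite mxtrace_mulC -!mulmxA.
Qed.

End Congruence.

End LogDet.

Section SelfConcordanceBound.
Variable R : realType.

Lemma sqr_powR32 (w : R) : 0 <= w -> (w ^+ 2) `^ (3 / 2) = w ^+ 3.
Proof.
move=> w0; rewrite -powR_mulrn// -powRrM.
by rewrite (_ : 2%:R * (3 / 2) = 3%:R) ?powR_mulrn//; lra.
Qed.

(* With [s = a + h] and [w^2 = a^2 + h^2 + 2 q] the left-hand side is
   [(3 s w^2 - s^3) / 2], which is maximal at [s = w]. *)
Lemma cubic_le_powR32 (a h q : R) : 0 <= a -> 0 <= h -> 0 <= q ->
  a ^+ 3 + h ^+ 3 + 3 * (a + h) * q <= (a ^+ 2 + h ^+ 2 + 2 * q) `^ (3 / 2).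
Proof.
move=> a0 h0 q0; have sum_ge0 : 0 <= a ^+ 2 + h ^+ 2 + 2 * q.
  by rewrite !addr_ge0 ?sqr_ge0// mulr_ge0.
set w := Num.sqrt (a ^+ 2 + h ^+ 2 + 2 * q).
have w0 : 0 <= w by exact: sqrtr_ge0.
have wE : w ^+ 2 = a ^+ 2 + h ^+ 2 + 2 * q by rewrite sqr_sqrtr.
rewrite -wE sqr_powR32// -subr_ge0.
have -> : w ^+ 3 - (a ^+ 3 + h ^+ 3 + 3 * (a + h) * q) =
          (w - (a + h)) ^+ 2 * (w + (a + h) / 2).
  have -> : q = (w ^+ 2 - a ^+ 2 - h ^+ 2) / 2 by rewrite wE; field.
  by field.
by rewrite mulr_ge0 ?sqr_ge0// addr_ge0// divr_ge0// addr_ge0.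
Qed.

Variables (p q : nat) (I : finType).

Lemma mxtrace_cubic_form_le (A : 'M[R]_q) (H : 'M[R]_p) (W : I -> 'M[R]_(p, q)) :
  A^T = A -> H^T = H ->
  `|\tr (A *m A *m A) + \tr (H *m H *m H) +
    3 * (\sum_i \tr (A *m ((W i)^T *m W i)) + \sum_i \tr ((W i)^T *m H *m W i))| <=
  (frob A ^+ 2 + frob H ^+ 2 + 2 * \sum_i frob (W i) ^+ 2) `^ (3 / 2).
Proof.
move=> AT HT; set w := \sum_i frob (W i) ^+ 2.
have w_ge0 : 0 <= w by apply: sumr_ge0 => i _; exact: sqr_ge0.
have AWW_le : `|\sum_i \tr (A *m ((W i)^T *m W i))| <= frob A * w.
  rewrite (le_trans (ler_norm_sum _ _ _))// mulr_sumr; apply: ler_sum => i _.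
  by rewrite mulmxA mxtrace_mulC mulmxA -{1}[W i]trmxK -(frob_tr (W i)) mxtrace_congr_le.
have WHW_le : `|\sum_i \tr ((W i)^T *m H *m W i)| <= frob H * w.
  rewrite (le_trans (ler_norm_sum _ _ _))// mulr_sumr; apply: ler_sum => i _.
  exact: mxtrace_congr_le.
apply: le_trans (cubic_le_powR32 (frob_ge0 A) (frob_ge0 H) w_ge0).
rewrite (le_trans (ler_normD _ _))// lerD//.
  by rewrite (le_trans (ler_normD _ _))// lerD ?mxtrace_cube_le.
rewrite normrM ger0_norm// -mulrA ler_wpM2l// mulrDl.
by rewrite (le_trans (ler_normD _ _))// lerD.
Qed.

Variables (S S1 : 'M[R]_q) (X X1 : 'M[R]_p) (Z : I -> 'M[R]_(p, q)).
Hypotheses (Spos : posdef S) (Xpos : posdef X) (S1T : S1^T = S1) (X1T : X1^T = X1).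

Let S2 : 'M[R]_q := - 2 *: \sum_i (Z i)^T *m invmx X *m Z i.
Let S3 : 'M[R]_q := 6 *: \sum_i (Z i)^T *m invmx X *m X1 *m invmx X *m Z i.

Lemma logdet_self_concordance_bound :
  0 <= - logdet_der2 S S1 S2 - logdet_der2 X X1 0 /\
  `|- logdet_der3 S S1 S2 S3 - logdet_der3 X X1 0 0| <=
    2 * (- logdet_der2 S S1 S2 - logdet_der2 X X1 0) `^ (3 / 2).
Proof.
have [G SE] := posdef_invmx_factor Spos; have [N XE] := posdef_invmx_factor Xpos.
pose A := congrmx G S1; pose H := congrmx N X1; pose W i := N^T *m Z i *m G.
have congrT k (M B : 'M[R]_k) : B^T = B -> (congrmx M B)^T = congrmx M B.
  by move=> BT; rewrite /congrmx !trmx_mul trmxK BT mulmxA.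
have AT : A^T = A by exact: congrT.
have HT : H^T = H by exact: congrT.
have S2E : congrmx G S2 = - 2 *: \sum_i (W i)^T *m W i.
  rewrite /congrmx /S2 -scalemxAr -scalemxAl mulmx_sumr mulmx_suml; congr (_ *: _).
  by apply: eq_bigr => i _; rewrite XE /W !trmx_mul trmxK !mulmxA.
have S3E : congrmx G S3 = 6 *: \sum_i (W i)^T *m H *m W i.
  rewrite /congrmx /S3 -scalemxAr -scalemxAl mulmx_sumr mulmx_suml; congr (_ *: _).
  by apply: eq_bigr => i _; rewrite XE /W !trmx_mul trmxK !mulmxA.
have congr0 : congrmx N 0 = 0 by rewrite /congrmx mulmx0 mul0mx.
have der2E : - logdet_der2 S S1 S2 - logdet_der2 X X1 0 =
    frob A ^+ 2 + frob H ^+ 2 + 2 * \sum_i frob (W i) ^+ 2.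
  rewrite (logdet_der2_congr SE) (logdet_der2_congr XE) S2E congr0 mxtraceZ mxtrace0.
  by rewrite (raddf_sum mxtrace) (eq_bigr _ (fun i _ => sqr_frob (W i))) !sqr_frob AT HT; ring.
have der3E : - logdet_der3 S S1 S2 S3 - logdet_der3 X X1 0 0 =
    - 2 * (\tr (A *m A *m A) + \tr (H *m H *m H) +
      3 * (\sum_i \tr (A *m ((W i)^T *m W i)) + \sum_i \tr ((W i)^T *m H *m W i))).
  rewrite (logdet_der3_congr SE) (logdet_der3_congr XE) S2E S3E congr0 mulmx0 -scalemxAr.
  rewrite !mxtraceZ !mxtrace0 mulmx_sumr !(raddf_sum mxtrace) -/A -/H; ring.
rewrite der3E der2E; split; last first.
  by rewrite normrM normrN normr_nat ler_wpM2l// mxtrace_cubic_form_le.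
by rewrite !addr_ge0 ?sqr_ge0// mulr_ge0// sumr_ge0// => i _; exact: sqr_ge0.
Qed.

End SelfConcordanceBound.

Section StrictCone.
Variables (R : realType) (V : normedModType R) (Phi : set {linear V -> R^o}).

Definition strict_cone : set V := [set s | forall f, Phi f -> 0 < f s].

Lemma strict_cone_convex x y (l : R) : strict_cone x -> strict_cone y -> 0 <= l <= 1 ->
  strict_cone (l *: x + (1 - l) *: y).
Proof.
move=> xK yK /andP[l_ge0 l_le1] f fPhi.
have -> : f (l *: x + (1 - l) *: y) = l * f x + (1 - l) * f y by rewrite linearD !linearZ.
move: l_ge0; rewrite le_eqVlt => /predU1P[<-|l_gt0].
  by rewrite mul0r add0r subr0 mul1r; exact: yK.
rewrite ltr_pwDl ?mulr_gt0//; first exact: xK.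
by rewrite mulr_ge0 ?subr_ge0// ltW//; exact: yK.
Qed.

Lemma cvg_ray (v s : V) : (t *: v + s) @[t --> (0 : R)^'+] --> s.
Proof.
rewrite -[X in _ --> X]add0r -(scale0r v).
exact/(cvg_at_right_filter (f := fun t => t *: v + s))/line_continuous.
Qed.

Variable e : V.
Hypothesis e_strict : strict_cone e.

Lemma strict_cone_ray s (t : R) : 0 < t -> (forall f, Phi f -> 0 <= f s) ->
  strict_cone (t *: e + s).
Proof.
move=> t_gt0 s_ge0 f fPhi; rewrite linearD linearZ ltr_pwDl//.
  by rewrite mulr_gt0//; exact: e_strict.
exact: s_ge0.
Qed.

Hypothesis Phi_continuous : forall f, Phi f -> continuous f.

Lemma closure_strict_coneE : closure strict_cone = [set s | forall f, Phi f -> 0 <= f s].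
Proof.
apply/seteqP; split=> [s sK f fPhi|s s_ge0 B sB].
  rewrite leNgt; apply/negP => fs_lt0.
  have /cvgr_lt/(_ 0 fs_lt0)/sK[y [/(_ f fPhi)]] : f y @[y --> s] --> f s.
    exact: Phi_continuous.
  by rewrite ltNge => /negP fy_gt0 /ltW.
have ray_near : \forall t \near (0 : R)^'+, B (t *: e + s) by exact: cvg_ray sB.
near (0 : R)^'+ => t; exists (t *: e + s); split; last by near: t.
by apply: strict_cone_ray.
Unshelve. all: by end_near. Qed.

Hypothesis strict_cone_open : open strict_cone.

Lemma interior_closure_strict_cone : interior (closure strict_cone) = strict_cone.
Proof.
apply/seteqP; split=> s; last first.
  by move=> sK; apply: (filterS (@subset_closure _ _)); exact: open_nbhs_nbhs.
rewrite /interior => sK.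
have ray_near : \forall t \near (0 : R)^'+, closure strict_cone (t *: - e + s).
  exact: cvg_ray sK.
near (0 : R)^'+ => t.
have -> : s = t *: e + (t *: - e + s) by rewrite scalerN addNKr.
apply: strict_cone_ray => //.
by have : closure strict_cone (t *: - e + s); [near: t|rewrite closure_strict_coneE].
Unshelve. all: by end_near. Qed.

Lemma closed_convex_cone_closure_strict_cone : closed_convex_cone (closure strict_cone).
Proof.
split; first exact: closed_closure.
- rewrite closure_strict_coneE => x y l x_ge0 y_ge0 /andP[l_ge0 l_le1] f fPhi.
  by rewrite linearD !linearZ addr_ge0// mulr_ge0 ?subr_ge0//; [exact: x_ge0|exact: y_ge0].
- rewrite closure_strict_coneE => x t x_ge0 t_ge0 f fPhi.
  by rewrite linearZ mulr_ge0//; exact: x_ge0.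
- by exists e; rewrite interior_closure_strict_cone.
Qed.

End StrictCone.

Section SecondOrderConvexity.
Variables (R : realType) (V : normedModType R) (D : set V) (F : V -> R).
Hypotheses (D_open : open D) (F_C2 : Ck_on D 2 F).

Lemma is_derive2_line x h (t : R) : D (t *: h + x) ->
  is_derive t 1 ('D_1 (fun s : R => F (s *: h + x))) ('D_h ('D_h F) (t *: h + x)).
Proof.
move=> Dt; have : is_derive t 1 (fun s : R => 'D_h F (s *: h + x)) ('D_h ('D_h F) (t *: h + x)).
  exact: (is_derive_line _ _ _ _ _).1 (Ck_onS_is_derive h (Ck_onS_derive h F_C2) Dt).
apply: near_eq_is_derive.
have preimage_open := open_comp (fun s _ => @line_continuous _ _ h x s) D_open.
apply: (open_near preimage_open Dt) => s Ds.
by have [_ ->] := (is_derive_line F x h s _).1 (Ck_onS_is_derive h F_C2 Ds).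
Qed.

Hypothesis D_convex : forall x y (l : R), D x -> D y -> 0 <= l <= 1 -> D (l *: x + (1 - l) *: y).

Lemma convex_of_derive2_ge0 : (forall x h, D x -> 0 <= 'D_h ('D_h F) x) ->
  forall x y (l : R), D x -> D y -> 0 <= l <= 1 ->
    F (l *: x + (1 - l) *: y) <= l * F x + (1 - l) * F y.
Proof.
move=> F2_ge0 x y l Dx Dy /andP[l0 l1].
pose h := y - x; pose line (t : R) : V := t *: h + x; pose f (t : R) : R^o := F (line t).
have lineE t : line t = (1 - t) *: x + (1 - (1 - t)) *: y.
  by rewrite /line /h subKr scalerBr scalerBl scale1r addrC addrA addrAC.
have D_line (t : R) : 0 <= t <= 1 -> D (line t).
  by move=> /andP[t0 t1]; rewrite lineE; apply: D_convex => //; rewrite subr_ge0 t1 gerBl t0.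
have D_line_oo (t : R) : t \in `]0, 1[ -> D (line t).
  by rewrite in_itv/= => /andP[t0 t1]; apply: D_line; rewrite !ltW.
have f_cont (t : R) : 0 <= t <= 1 -> {for t, continuous f}.
  move=> /D_line Dt; apply: continuous_comp; first exact: line_continuous.
  exact: Ck_on_continuous F_C2 Dt.
have f_derivable (t : R) : t \in `]0, 1[ -> derivable f t 1.
  move=> /D_line_oo Dt.
  by have [] := (is_derive_line F x h t _).1 (Ck_onS_is_derive h F_C2 Dt).
have Df_der (t : R) : t \in `]0, 1[ -> is_derive t 1 ('D_1 f) ('D_h ('D_h F) (line t)).
  by move=> /D_line_oo; exact: is_derive2_line.
have D2f_ge0 t : 0 < t < 1 -> 0 <= 'D_1 ('D_1 f) t.
  move=> t01; have t_oo : t \in `]0, 1[ by rewrite in_itv.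
  by have [_ ->] := Df_der t t_oo; exact/F2_ge0/D_line_oo.
have f_cvg1 : f t @[t --> 1^'-] --> f 1.
  by apply/cvg_at_left_filter/f_cont; rewrite ler01 lexx.
have f_cvg0 : f t @[t --> 0^'+] --> f 0.
  by apply/cvg_at_right_filter/f_cont; rewrite ler01 lexx.
have Df_derivable (t : R) : t \in `]0, 1[ -> derivable ('D_1 f) t 1 by move=> /Df_der[].
have := second_derivative_convex D2f_ge0 f_cvg1 f_cvg0 f_derivable Df_derivable (Itv01 l0 l1) ler01.
rewrite !convRE/= /unstable.onem mulr0 add0r mulr1 /f !lineE.
by rewrite subKr !subr0 !subrr subr0 !scale1r !scale0r addr0 add0r.
Qed.

End SecondOrderConvexity.

Section SchurBarrier.
Variables (R : realType) (V : normedModType R) (p q : nat) (I : finType).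
Variables (W : {linear V -> 'M[R]_q}) (X : {linear V -> 'M[R]_p}).
Variable Y : I -> {linear V -> 'M[R]_(p, q)}.
Hypotheses (W_continuous : continuous W) (X_continuous : continuous X).
Hypothesis Y_continuous : forall i, continuous (Y i).
Hypotheses (W_sym : forall s, (W s)^T = W s) (X_sym : forall s, (X s)^T = X s).

Definition schur s : 'M[R]_q := W s - \sum_i (Y i s)^T *m invmx (X s) *m Y i s.

Definition schur_dom : set V := [set s | posdef (X s) /\ posdef (schur s)].

Definition schur_barrier s : R := - ln (\det (schur s)) - ln (\det (X s)).

Lemma schur_sym s : (schur s)^T = schur s.
Proof.
rewrite /schur linearB/= W_sym linear_sum/=; congr (_ - _); apply: eq_bigr => i _.
by rewrite !trmx_mul trmxK trmx_inv X_sym mulmxA.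
Qed.

Lemma schurZ s (t : R) : t != 0 -> X s \in unitmx -> schur (t *: s) = t *: schur s.
Proof.
move=> tN0 Xu; rewrite /schur linearZ/= scalerBr scaler_sumr; congr (_ - _).
apply: eq_bigr => i _.
rewrite !linearZ/= invmxZ ?unitmxZ ?unitfE// -!(scalemxAl, scalemxAr) !scalerA.
by rewrite mulfK.
Qed.

Let Xdom : set V := [set s | posdef (X s)].

Let X_unit s : Xdom s -> X s \in unitmx.
Proof. exact: posdef_unit. Qed.

Lemma open_posdef_X : open Xdom.
Proof.
rewrite openE => s /posdef_near Xnear.
have : \forall y \near s, (X y)^T = X y -> posdef (X y) by exact: X_continuous Xnear.
by apply: filterS => y; apply; exact: X_sym.
Qed.

Lemma Ck_on_schur k : Ck_on Xdom k schur.
Proof.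
have Xdom_open := open_posdef_X.
have YC i : Ck_on Xdom k (Y i) by exact: Ck_on_linear.
apply: Ck_onD => //; first exact: Ck_on_linear.
apply: Ck_onN => //; apply: Ck_on_sum => // i; apply: Ck_on_mulmx => //.
apply: Ck_on_mulmx => //; first exact: Ck_on_trmx.
by apply: Ck_on_invmx => //; exact: Ck_on_linear.
Qed.

Lemma open_schur_dom : open schur_dom.
Proof.
rewrite openE => s [Xpos /posdef_near Snear]; have Xdom_open := open_posdef_X.
have : \forall y \near s, (schur y)^T = schur y -> posdef (schur y).
  exact: (Ck_on_continuous (Ck_on_schur 0) Xpos) Snear.
by apply: filterS2 (open_nbhs_nbhs (conj Xdom_open Xpos)) => y Xy /(_ (schur_sym y)).
Qed.

Lemma Ck_on_schur_dom k : Ck_on schur_dom k schur.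
Proof. by apply: Ck_on_subset (Ck_on_schur k) => s []. Qed.

Let schur_unit s : schur_dom s -> schur s \in unitmx.
Proof. by move=> [_ /posdef_unit]. Qed.

Lemma Ck_on_schur_barrier k : Ck_on schur_dom k schur_barrier.
Proof.
have dom_open := open_schur_dom.
have schurC := Ck_on_schur_dom k.
apply: Ck_onD => //; apply: Ck_onN => //; apply: Ck_on_ln => //.
- by move=> y [_ /posdef_det_gt0].
- exact: Ck_on_det.
- by move=> y [/posdef_det_gt0].
- by apply: Ck_on_det => //; exact: Ck_on_linear.
Qed.

Section Derivatives.
Variable h : V.

Definition residual i s : 'M[R]_(p, q) := Y i h - X h *m (invmx (X s) *m Y i s).

Definition schur_der1 s : 'M[R]_q :=
  W h - \sum_i ((Y i h)^T *m (invmx (X s) *m Y i s) + (invmx (X s) *m Y i s)^T *m residual i s).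

Definition schur_der2 s : 'M[R]_q :=
  - 2 *: \sum_i (residual i s)^T *m invmx (X s) *m residual i s.

Definition schur_der3 s : 'M[R]_q :=
  6 *: \sum_i (residual i s)^T *m invmx (X s) *m X h *m invmx (X s) *m residual i s.

Let invX_sym s : (invmx (X s))^T = invmx (X s).
Proof. by rewrite trmx_inv X_sym. Qed.

Let invX_der s : Xdom s ->
  is_derive s h (fun y => invmx (X y)) (- (invmx (X s) *m X h *m invmx (X s))).
Proof.
move=> Xs; have Xdom_open := open_posdef_X.
apply: (is_derive_invmx Xdom_open X_unit) => //.
  exact: Ck_on_linear.
exact: is_derive_linear.
Qed.

Let invXY_der i s : Xdom s ->
  is_derive s h (fun y => invmx (X y) *m Y i y) (invmx (X s) *m residual i s).
Proof.
move=> Xs; have Y_der := is_derive_linear s h (@Y_continuous i).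
apply: is_derive_eq (is_derive_mulmx (invX_der Xs) Y_der) _.
by rewrite /residual mulmxBr mulNmx !mulmxA addrC.
Qed.

Let residual_der i s : Xdom s ->
  is_derive s h (residual i) (- (X h *m (invmx (X s) *m residual i s))).
Proof.
move=> Xs; have Xh_der := is_derive_cst (X h) s h.
have XhG_der := is_derive_mulmx Xh_der (invXY_der i Xs).
apply: is_derive_eq (is_deriveB (is_derive_cst (Y i h) s h) XhG_der) _.
by rewrite mul0mx !add0r.
Qed.

Lemma is_derive_schur s : Xdom s -> is_derive s h schur (schur_der1 s).
Proof.
move=> Xs; have YT_der i := is_derive_trmx (is_derive_linear s h (@Y_continuous i)).
have W_der := is_derive_linear s h W_continuous.
have -> : schur = fun y => W y - \sum_i (Y i y)^T *m (invmx (X y) *m Y i y).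
  by apply/funext => y; congr (_ - _); apply: eq_bigr => i _; rewrite mulmxA.
have YTG_der i := is_derive_mulmx (YT_der i) (invXY_der i Xs).
apply: is_derive_eq (is_deriveB W_der (is_derive_bigsum _ _ YTG_der)) _.
congr (_ - _); apply: eq_bigr => i _.
by rewrite trmx_mul invX_sym !mulmxA.
Qed.

Lemma is_derive_schur_der1 s : Xdom s -> is_derive s h schur_der1 (schur_der2 s).
Proof.
move=> Xs; have YT_der i := is_derive_cst (Y i h)^T s h.
apply: is_derive_eq.
  apply: is_deriveB (is_derive_cst (W h) s h) _; apply: is_derive_bigsum => i.
  apply: is_deriveD (is_derive_mulmx (YT_der i) (invXY_der i Xs)) _.
  exact: is_derive_mulmx (is_derive_trmx (invXY_der i Xs)) (residual_der i Xs).
rewrite add0r /schur_der2 scaleNr scaler_sumr; congr (- _); apply: eq_bigr => i _.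
have residualT : (residual i s)^T = (Y i h)^T - (invmx (X s) *m Y i s)^T *m X h.
  by rewrite linearB/= !trmx_mul X_sym.
rewrite mul0mx add0r mulmxN addrCA [_^T *m (X h *m _)]mulmxA -mulmxBl -residualT.
by rewrite trmx_mul invX_sym mulmxA scaler_nat mulr2n.
Qed.

Lemma is_derive_schur_der2 s : Xdom s -> is_derive s h schur_der2 (schur_der3 s).
Proof.
move=> Xs; have resT_der i := is_derive_trmx (residual_der i Xs).
apply: is_derive_eq.
  apply: is_deriveZ; apply: is_derive_bigsum => i.
  exact: is_derive_mulmx (is_derive_mulmx (resT_der i) (invX_der Xs)) (residual_der i Xs).
rewrite /schur_der3 (_ : 6 = - 2 * - 3) -?scalerA; last by ring.
congr (_ *: _); rewrite scaler_sumr; apply: eq_bigr => i _.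
rewrite linearN/= !trmx_mul X_sym invX_sym !(mulNmx, mulmxN) mulmxDl !(mulNmx, mulmxN) !mulmxA.
by rewrite scaleNr scaler_nat 2!mulrSr mulr1n !opprD.
Qed.

Lemma schur_der1_sym s : (schur_der1 s)^T = schur_der1 s.
Proof.
rewrite linearB/= W_sym linear_sum/=; congr (_ - _); apply: eq_bigr => i _.
by rewrite /residual linearD mulmxBr linearB/= !trmx_mul !trmxK X_sym !mulmxA addrCA.
Qed.

Let X_der s : is_derive s h X (X h).
Proof. exact: is_derive_linear. Qed.

Lemma derive_schur_barrier s : schur_dom s -> 'D_h schur_barrier s =
  - logdet_der1 (schur s) (schur_der1 s) - logdet_der1 (X s) (X h).
Proof.
move=> [Xs Ss]; have S_der := is_derive_ln_det (posdef_det_gt0 Ss) (is_derive_schur Xs).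
by have [_ ->] := is_deriveB (is_deriveN S_der) (is_derive_ln_det (posdef_det_gt0 Xs) (X_der s)).
Qed.

Lemma derive2_schur_barrier s : schur_dom s -> 'D_h ('D_h schur_barrier) s =
  - logdet_der2 (schur s) (schur_der1 s) (schur_der2 s) - logdet_der2 (X s) (X h) 0.
Proof.
move=> Ds; have Xdom_open := open_posdef_X; have dom_open := open_schur_dom.
rewrite (near_eq_derive _ (open_near dom_open Ds derive_schur_barrier)).
have S_der := is_derive_logdet_der1 dom_open schur_unit (Ck_on_schur_dom 1)
  (fun y Dy => is_derive_schur Dy.1) (fun y Dy => is_derive_schur_der1 Dy.1) Ds.
have Xh_der := is_derive_logdet_der1 Xdom_open X_unit (Ck_on_linear Xdom_open 1 X_continuous)
  (fun y _ => X_der y) (fun y _ => is_derive_cst (X h) y h) Ds.1.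
by have [_ ->] := is_deriveB (is_deriveN S_der) Xh_der.
Qed.

Lemma derive3_schur_barrier s : schur_dom s -> 'D_h ('D_h ('D_h schur_barrier)) s =
  - logdet_der3 (schur s) (schur_der1 s) (schur_der2 s) (schur_der3 s)
  - logdet_der3 (X s) (X h) 0 0.
Proof.
move=> Ds; have Xdom_open := open_posdef_X; have dom_open := open_schur_dom.
rewrite (near_eq_derive _ (open_near dom_open Ds derive2_schur_barrier)).
have S_der := is_derive_logdet_der2 dom_open schur_unit (Ck_on_schur_dom 1)
  (fun y Dy => is_derive_schur Dy.1) (fun y Dy => is_derive_schur_der1 Dy.1)
  (fun y Dy => is_derive_schur_der2 Dy.1) Ds.
have Xh_der := is_derive_logdet_der2 Xdom_open X_unit (Ck_on_linear Xdom_open 1 X_continuous)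
  (fun y _ => X_der y) (fun y _ => is_derive_cst (X h) y h)
  (fun y _ => is_derive_cst 0 y h) Ds.1.
by have [_ ->] := is_deriveB (is_deriveN S_der) Xh_der.
Qed.

Lemma schur_barrier_self_concordant s : schur_dom s ->
  0 <= 'D_h ('D_h schur_barrier) s /\
  `|'D_h ('D_h ('D_h schur_barrier)) s| <= 2 * ('D_h ('D_h schur_barrier) s) `^ (3 / 2).
Proof.
move=> Ds; rewrite (derive3_schur_barrier Ds) (derive2_schur_barrier Ds); case: Ds => Xs Ss.
exact: logdet_self_concordance_bound (schur_der1_sym s) (X_sym h).
Qed.

End Derivatives.

Definition arrow_form (x : 'cV[R]_q) (z : I -> 'cV[R]_p) s : R :=
  qform x (W s) + 2 * (\sum_i mxform (z i) x (Y i s)) + \sum_i qform (z i) (X s).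

Fact arrow_form_is_linear x z : linear (arrow_form x z : V -> R^o).
Proof.
move=> t s r; rewrite /arrow_form !linearP/=.
under eq_bigr do rewrite !linearP/=.
under [\sum_i qform (z i) _]eq_bigr do rewrite linearP.
by rewrite !big_split/= -!mulr_sumr /GRing.scale/=; ring.
Qed.

HB.instance Definition _ x z :=
  GRing.isLinear.Build R V R^o *:%R (arrow_form x z) (arrow_form_is_linear x z).

Lemma arrow_form_complete_square x z s : X s \in unitmx ->
  arrow_form x z s = qform x (schur s) + \sum_i qform (z i + invmx (X s) *m Y i s *m x) (X s).
Proof.
move=> Xu; under eq_bigr do rewrite qform_complete_square//.
rewrite !big_split/= -mulr_sumr /schur linearB linear_sum /arrow_form; ring.
Qed.

Definition arrow_constraints : set {linear V -> R^o} :=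
  [set f | (exists2 z, z != 0 & f = (qform z \o X : {linear V -> R^o})) \/
           (exists x z, x != 0 /\ f = (arrow_form x z : {linear V -> R^o}))].

Lemma arrow_constraints_continuous f : arrow_constraints f -> continuous f.
Proof.
have form_cont m n (y : 'cV[R]_m) (x : 'cV[R]_n) (A : V -> 'M[R]_(m, n)) :
    continuous A -> continuous (fun s => mxform y x (A s)).
  move=> A_cont s; apply: continuous_comp; first exact: A_cont.
  exact: mx_linear_continuous.
move=> [[z _ ->]|[x [z [_ ->]]]]; first exact: form_cont.
have sum_cont (F : I -> V -> R) :
    (forall i, continuous (F i)) -> continuous (fun s => \sum_i F i s).
  by move=> F_cont; apply: continuous_big => [|i _]; [exact: add_continuous|exact: F_cont].
have cross_cont := sum_cont _ (fun i => form_cont _ _ (z i) x _ (@Y_continuous i)).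
have diag_cont := sum_cont _ (fun i => form_cont _ _ (z i) (z i) _ X_continuous).
move=> s; apply: cvgD (diag_cont s); apply: cvgD (form_cont _ _ x x _ W_continuous s) _.
by apply: cvgM (cross_cont s); exact: cvg_cst.
Qed.

Lemma schur_domE : schur_dom = strict_cone arrow_constraints.
Proof.
apply/seteqP; split=> s.
  move=> [Xpos Spos] f [[z zN0 ->]|[x [z [xN0 ->]]]]; first exact: Xpos.2.
  rewrite /= arrow_form_complete_square ?posdef_unit// ltr_pwDl//; first exact: Spos.2.
  by apply: sumr_ge0 => i _; exact: (posdefW Xpos).2.
move=> s_gt0; have Xpos : posdef (X s).
  by split=> // z zN0; apply: (s_gt0 (qform z \o X)); left; exists z.
split=> //; split; first exact: schur_sym.
move=> x xN0; pose z i := - (invmx (X s) *m Y i s *m x).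
have : 0 < arrow_form x z s by apply: (s_gt0 (arrow_form x z)); right; exists x, z.
rewrite arrow_form_complete_square ?posdef_unit// big1 ?addr0// => i _.
by rewrite addNr mxform0l.
Qed.

Lemma qform_schur_le s x : possemidef (X s) -> X s \in unitmx ->
  qform x (schur s) <= qform x (W s).
Proof.
move=> [_ X_ge0] Xu; have <- : arrow_form x (fun=> 0) s = qform x (W s).
  by rewrite /arrow_form !big1 ?mulr0 ?addr0// => i _; rewrite mxform0l.
by rewrite arrow_form_complete_square// lerDl sumr_ge0.
Qed.

Variable e : V.
Hypothesis e_dom : schur_dom e.

Let e_strict : strict_cone arrow_constraints e.
Proof. by rewrite -schur_domE. Qed.

Let arrow_constraints_ge0 s f : closure schur_dom s -> arrow_constraints f -> 0 <= f s.
Proof.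
rewrite schur_domE (closure_strict_coneE e_strict arrow_constraints_continuous) => s_ge0.
exact: s_ge0.
Qed.

Lemma interior_closure_schur_dom : interior (closure schur_dom) = schur_dom.
Proof.
have dom_open := open_schur_dom; rewrite schur_domE in dom_open *.
exact: interior_closure_strict_cone e_strict arrow_constraints_continuous dom_open.
Qed.

Lemma closed_convex_cone_closure_schur_dom : closed_convex_cone (closure schur_dom).
Proof.
have dom_open := open_schur_dom; rewrite schur_domE in dom_open *.
exact: closed_convex_cone_closure_strict_cone e_strict arrow_constraints_continuous dom_open.
Qed.

Lemma schur_dom_convex x y (l : R) : schur_dom x -> schur_dom y -> 0 <= l <= 1 ->
  schur_dom (l *: x + (1 - l) *: y).
Proof. by rewrite schur_domE; exact: strict_cone_convex. Qed.

Lemma closure_possemidef_X s : closure schur_dom s -> possemidef (X s).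
Proof.
move=> sK; split=> // z; have [->|zN0] := eqVneq z 0; first by rewrite mxform0l.
by apply: (arrow_constraints_ge0 (f := qform z \o X) sK); left; exists z.
Qed.

Lemma closure_possemidef_schur s : closure schur_dom s -> X s \in unitmx -> possemidef (schur s).
Proof.
move=> sK Xu; split=> [|x]; first exact: schur_sym.
have [->|xN0] := eqVneq x 0; first by rewrite mxform0l.
pose z i := - (invmx (X s) *m Y i s *m x).
have : 0 <= arrow_form x z s by apply: (arrow_constraints_ge0 sK); right; exists x, z.
rewrite arrow_form_complete_square// big1 ?addr0// => i _.
by rewrite addNr mxform0l.
Qed.

Lemma boundary_det_eq0 s : closure schur_dom s -> ~ schur_dom s ->
  \det (X s) != 0 -> \det (schur s) = 0.
Proof.
move=> sK sN XN0; have Xu : X s \in unitmx by rewrite unitmxE unitfE.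
apply: contra_notP sN => /eqP SN0; split.
  exact: possemidef_unit_posdef (closure_possemidef_X sK) Xu.
apply: possemidef_unit_posdef; first exact: closure_possemidef_schur.
by rewrite unitmxE unitfE.
Qed.

Lemma det_schur_le s : schur_dom s -> \det (schur s) <= \det (W s).
Proof.
move=> [Xpos Spos]; apply: posdef_det_le => // x.
by apply: qform_schur_le; [exact: posdefW|exact: posdef_unit].
Qed.

Section Boundary.
Variables (u : nat -> V) (s : V).
Hypotheses (u_dom : forall k, schur_dom (u k)) (u_cvg : u @ \oo --> s).

Lemma boundary_det_mul_cvg0 : closure schur_dom s -> ~ schur_dom s ->
  \det (schur (u k)) * \det (X (u k)) @[k --> \oo] --> (0 : R).
Proof.
move=> sK sN; have V_open : open [set: V] by exact: openT.
have comp_cvg (f : V -> R) : {for s, continuous f} -> f (u k) @[k --> \oo] --> f s.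
  by move=> f_cont; exact: cvg_comp u_cvg f_cont.
have det_cvg n (A : {linear V -> 'M[R]_n}) : continuous A ->
    \det (A (u k)) @[k --> \oo] --> \det (A s).
  move=> A_cont; apply: (comp_cvg (fun y => \det (A y))).
  by apply: Ck_on_continuous (Ck_on_det V_open (Ck_on_linear V_open 0 A_cont)) _.
have [X0|XN0] := eqVneq (\det (X s)) 0.
  have bound_cvg : \det (W (u k)) * \det (X (u k)) @[k --> \oo] --> 0.
    by rewrite -[X in _ --> X](mulr0 (\det (W s))) -X0; apply: cvgM; exact: det_cvg.
  apply: squeeze_cvgr (cvg_cst 0) bound_cvg; near=> k; have [Xk Sk] := u_dom k.
  rewrite mulr_ge0 ?(ltW (posdef_det_gt0 _))//=.
  by rewrite ler_wpM2r ?(ltW (posdef_det_gt0 _))// det_schur_le.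
rewrite -[X in _ --> X](mul0r (\det (X s))) -(boundary_det_eq0 sK sN XN0).
apply: cvgM; last exact: det_cvg.
have Xpos : posdef (X s).
  by apply: possemidef_unit_posdef; [exact: closure_possemidef_X|rewrite unitmxE unitfE].
apply: (comp_cvg (fun y => \det (schur y))).
exact: Ck_on_continuous (Ck_on_det open_posdef_X (Ck_on_schur 0)) Xpos.
Unshelve. all: by end_near. Qed.

Lemma schur_barrier_cvg_pinfty : closure schur_dom s -> ~ schur_dom s ->
  (schur_barrier \o u) @ \oo --> +oo.
Proof.
move=> sK sN; apply/cvgryPge => a.
have /cvgr_lt/(_ (expR (- a)) (expR_gt0 _)) := boundary_det_mul_cvg0 sK sN.
apply: filterS => k det_lt; have [/posdef_det_gt0 Xk /posdef_det_gt0 Sk] := u_dom k.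
rewrite /= /schur_barrier -opprD lerNr -lnM ?posrE//.
by rewrite -[leRHS]expRK ler_ln ?posrE ?expR_gt0 ?mulr_gt0// ltW.
Qed.

End Boundary.

Lemma schur_barrier_log_homogeneous s (t : R) : schur_dom s -> 0 < t ->
  schur_barrier (t *: s) = schur_barrier s - (p + q)%:R * ln t.
Proof.
move=> [Xpos Spos] t_gt0.
rewrite /schur_barrier schurZ ?gt_eqF ?posdef_unit// linearZ/= !detZ.
rewrite !lnM ?posrE ?exprn_gt0 ?posdef_det_gt0// (lnXn q t_gt0) (lnXn p t_gt0).
by rewrite natrD; ring.
Qed.

Lemma schur_barrier_LHSCB : LHSCB (closure schur_dom) schur_barrier (p + q)%:R.
Proof.
rewrite /LHSCB interior_closure_schur_dom.
split; first exact: closed_convex_cone_closure_schur_dom.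
split; first exact/Ck_on_C3_on/Ck_on_schur_barrier.
split.
- apply: convex_of_derive2_ge0 open_schur_dom (Ck_on_schur_barrier 2) schur_dom_convex _.
  by move=> s h /(schur_barrier_self_concordant h)[].
- exact: schur_barrier_cvg_pinfty.
- by move=> s h /(schur_barrier_self_concordant h)[].
- exact: schur_barrier_log_homogeneous.
Qed.

End SchurBarrier.

Section DualSosCone.
Variables (R : realType) (U L : nat) (P : 'M[R]_(U, L)).

Fact Lam_is_linear : linear (Lam P).
Proof. by move=> t a b; rewrite /Lam !linearP/= mulmxDl -scalemxAl. Qed.

HB.instance Definition _ := GRing.isLinear.Build R 'cV[R]_U 'M[R]_L *:%R (Lam P) Lam_is_linear.

Lemma Lam_sym a : (Lam P a)^T = Lam P a.
Proof. by rewrite /Lam !trmx_mul trmxK tr_diag_mx mulmxA. Qed.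

Lemma Lam_const1 : Lam P (const_mx 1) = P^T *m P.
Proof. by rewrite /Lam trmx_const diag_const_mx mulmx1. Qed.

Variable k : nat.

Definition Lam_col (j : 'I_k.+1) (s : 'M[R]_(U, k.+1)) : 'M[R]_L := Lam P (col j s).

HB.instance Definition _ j := GRing.Linear.copy (Lam_col j) (Lam P \o col j).

Lemma Lam1E : Lam1 P = Lam_col ord0.
Proof. by apply/funext => s; rewrite /Lam1 (big_pred1 ord0). Qed.

Lemma PiE : Pi P = schur (Lam_col ord0) (Lam_col ord0) (fun i : 'I_k => Lam_col (lift ord0 i)).
Proof.
apply/funext => s; rewrite /Pi Lam1E /schur big_mkcond big_ord_recl/= add0r.
by congr (_ - _); apply: eq_bigr => i _; rewrite Lam_sym.
Qed.

Lemma KintE : Kint k.+1 P =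
  schur_dom (Lam_col ord0) (Lam_col ord0) (fun i : 'I_k => Lam_col (lift ord0 i)).
Proof. by rewrite /Kint Lam1E PiE. Qed.

Lemma FbarE : @Fbar R U L k.+1 P =
  schur_barrier (Lam_col ord0) (Lam_col ord0) (fun i : 'I_k => Lam_col (lift ord0 i)).
Proof. by apply/funext => s; rewrite /Fbar Lam1E PiE. Qed.

Hypothesis P_inj : forall v : 'cV[R]_L, P *m v = 0 -> v = 0.

Lemma posdef_gram : posdef (P^T *m P).
Proof.
split=> [|x xN0]; first by rewrite trmx_mul trmxK.
rewrite mulmxA -trmx_mul -mulmxA -trace_mx11 -sqr_frob exprn_gt0// frob_gt0.
by apply: contra xN0 => /eqP/P_inj ->.
Qed.

Lemma schur_dom_first_column :
  schur_dom (Lam_col ord0) (Lam_col ord0) (fun i : 'I_k => Lam_col (lift ord0 i))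
    (\matrix_(u, j) (j == ord0)%:R).
Proof.
set e := \matrix_(u, j) _.
have X_e : Lam_col ord0 e = P^T *m P.
  by rewrite -Lam_const1; congr Lam; apply/matrixP => u j; rewrite !mxE.
have Y_e i : Lam_col (lift ord0 i) e = 0.
  by rewrite -[RHS](linear0 (Lam P)); congr Lam; apply/matrixP => u j; rewrite !mxE.
split; first by rewrite /= X_e; exact: posdef_gram.
rewrite /schur /= X_e big1 ?subr0 => [|i _]; first exact: posdef_gram.
by rewrite Y_e mulmx0.
Qed.

Let X_continuous : continuous (Lam_col ord0).
Proof. exact: mx_linear_continuous. Qed.

Let Y_continuous (i : 'I_k) : continuous (Lam_col (lift ord0 i)).
Proof. exact: mx_linear_continuous. Qed.

Let X_sym s : (Lam_col ord0 s)^T = Lam_col ord0 s.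
Proof. exact: Lam_sym. Qed.

Lemma interior_Kstar : interior (Kstar k.+1 P) = Kint k.+1 P.
Proof.
by rewrite /Kstar KintE; apply: interior_closure_schur_dom schur_dom_first_column.
Qed.

Lemma Fbar_LHSCB : LHSCB (Kstar k.+1 P) (Fbar P) (2 * L)%:R.
Proof.
rewrite /Kstar KintE FbarE [(2 * L)%N]mul2n -addnn.
by apply: schur_barrier_LHSCB schur_dom_first_column.
Qed.

End DualSosCone.

Lemma evmx_mul_eq0 (R : realType) (n d U L : nat) (t : 'I_U -> 'I_n -> R)
    (p : 'I_L -> mpolyR n R) (v : 'cV[R]_L) :
  unisolvent (2 * d) t -> is_basis_polys d p -> evmx t p *m v = 0 -> v = 0.
Proof.
move=> t_unisolvent [p_deg p_free _] Pv0; apply/matrixP => l j; rewrite ord1 mxE.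
apply: (p_free (fun l => v l 0)) => {l j}; apply: t_unisolvent.
  rewrite /deg_le; apply: leq_trans (msize_sum _ _ _) _.
  apply/bigmax_leqP => l _; apply: leq_trans (msizeZ_le _ _) _.
  by apply: leq_trans (p_deg l) _; rewrite ltnS leq_pmull.
move=> u; have := congr1 (fun A : 'cV[R]_U => A u 0) Pv0; rewrite !mxE => Pvu0.
rewrite raddf_sum/= -[RHS]Pvu0; apply: eq_bigr => l _.
by rewrite mevalZ mxE mulrC.
Qed.

Theorem theorem1 (R : realType) (n d m : nat) (t : 'I_('C(n + 2 * d, n)) -> 'I_n -> R)
  (p : 'I_('C(n + d, n)) -> mpolyR n R) :
  (1 <= n)%N -> (1 <= d)%N -> (2 <= m)%N ->
  unisolvent (2 * d) t -> is_basis_polys d p ->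
  let P := evmx t p in
  interior (Kstar m P) = Kint m P /\
  LHSCB (Kstar m P) (Fbar P) (2 * 'C(n + d, n))%:R.
Proof.
move=> _ _; case: m => // k _ t_unisolvent p_basis P.
have P_inj v : P *m v = 0 -> v = 0 := evmx_mul_eq0 t_unisolvent p_basis.
by split; [exact: interior_Kstar|exact: Fbar_LHSCB].
Qed.
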